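(* Let $R$ be a commutative ring with identity, $G$ a topological group acting continuously on a path-connected topological space $X$, and $E$ a $G$-equivariant $R$-oriented real vector bundle over $X$ of rank $r$ such that the action of $G$ preserves the $R$-orientation. Suppose $e(E)=0$. Then for every $R$-oriented secondary Thom class $a_E\in H^{r-1}(\mathrm{Tot}_0(E),R)$ and for every secondary equivariant Euler class $se_G(E)\in H^{r-1}(G\times X,R)$ the equality $$\partial\Phi^*(a_E)=-se_G(E)$$ holds up to the indeterminacy submodule $M_X^{r-1}$, i.e. in $H^{r-1}(G\times X,R)/M_X^{r-1}$.
   Context: $\mathrm{Tot}_0(E)$ is the total space of $E$ minus the zero section, $p_0\colon\mathrm{Tot}_0(E)\to X$ the projection. An $R$-oriented secondary Thom class is a class $a_E\in H^{r-1}(\mathrm{Tot}_0(E),R)$ with $\delta(a_E)=u_E$, where $u_E\in H^r(\mathrm{Tot}(E),\mathrm{Tot}_0(E),R)$ is the Thom class and $\delta$ the connecting homomorphism of the pair (the singular cochain differential is the dual of the chain differential, no extra sign). $\varphi,p_2\colon G\times X\to X$ are the action and the projection; $\Phi,P_2\colon G\times\mathrm{Tot}_0(E)\to\mathrm{Tot}_0(E)$ are the action and the projection. Indeterminacy submodule: $M_X^*=\mathrm{Im}(\varphi^*-p_2^*\colon H^*(X,R)\to H^*(G\times X,R))$. Since $e(E)=0$, $(\mathrm{id}\times p_0)^*$ is injective, and $\partial\Phi^*(a_E)\in H^{r-1}(G\times X,R)$ is the unique class with $(\mathrm{id}\times p_0)^*(\partial\Phi^*(a_E))=\Phi^*(a_E)-P_2^*(a_E)$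 (it exists). The naive homotopy quotient $X_{nG}$ is the homotopy coequaliser of $\varphi$ and $p_2$: the quotient of $(G\times X\times[0,1])\sqcup X$ by $(g,x,0)\sim x$, $(g,x,1)\sim gx$. There is a long exact sequence $$\cdots\to H^{*-1}(X,R)\xrightarrow{\varphi^*-p_2^*}H^{*-1}(G\times X,R)\xrightarrow{\delta}H^*(X_{nG},R)\to H^*(X,R)\to\cdots$$ with $\delta$ induced by the map $X_{nG}\to\Sigma(G\times X)_+$ collapsing $X$. The bundle $E_{nG}$ over $X_{nG}$ is the vector bundle with total space $(\mathrm{Tot}E)_{nG}$ (equivalently, glued from $E$ via the canonical isomorphism $\varphi^*E\cong p_2^*E$). A secondary equivariant Euler class of $E$ is a class $se_G(E)\in H^{r-1}(G\times X,R)$ with $\delta(se_G(E))=e(E_{nG})$. *)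

(* Defs.v *)
From HB Require Import structures.
From mathcomp Require Import all_boot all_order all_algebra.
From mathcomp Require Import zify.
From mathcomp Require Import all_classical all_reals topology normedtype.

Set Implicit Arguments.
Unset Strict Implicit.
Unset Printing Implicit Defensive.

(* MathComp-Analysis; [RR : realType] is the field of real numbers and
   [R : comPzRingType] the ring of coefficients. *)

Import Order.TTheory GRing.Theory Num.Theory.
Import numFieldNormedType.Exports.

Local Open Scope classical_set_scope.
Local Open Scope ring_scope.
Local Open Scope quotient_scope.

(** * Topological preliminaries *)

HB.mixin Record Group_isTopologicalGroup (G : Type)
    of Group G & Topological G := {
  mulg_continuous : continuous (fun gh : G * G => (gh.1 * gh.2)%g);
  invg_continuous : continuous (fun g : G => (g^-1)%g)
}.

#[short(type="topologicalGroupType")]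
HB.structure Definition TopologicalGroup :=
  {G of Group_isTopologicalGroup G & Group G & Topological G}.

Section sum_topology.
Context {X Y : topologicalType}.

Definition sum_open (U : set (X + Y)) :=
  open ((@inl X Y) @^-1` U) /\ open ((@inr X Y) @^-1` U).

Lemma sum_openT : sum_open setT.
Proof. by split; rewrite preimage_setT; exact: openT. Qed.

Lemma sum_openI : setI_closed sum_open.
Proof.
by move=> U V [U1 U2] [V1 V2]; split; rewrite preimage_setI; exact: openI.
Qed.

Lemma sum_open_bigcup (I : Type) (f : I -> set (X + Y)) :
  (forall i, sum_open (f i)) -> sum_open (\bigcup_i f i).
Proof.
move=> of_; split; rewrite preimage_bigcup; apply: bigcup_open => i _.
- by case: (of_ i).
- by case: (of_ i).
Qed.

HB.instance Definition _ := isOpenTopological.Build (X + Y)%type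
  sum_openT sum_openI sum_open_bigcup.

End sum_topology.

Section continuous_maps.

Lemma ccont (X Y : topologicalType) (f : continuousType X Y) : continuous f.
Proof. exact: cts_fun. Qed.

(* Composition in diagrammatic order: first [f], then [g]. *)
Definition ccomp (X Y Z : topologicalType) (f : continuousType X Y)
  (g : continuousType Y Z) : continuousType X Z := g \o f.

Lemma pair_continuous (W X Y : topologicalType) (f : W -> X) (g : W -> Y) :
  continuous f -> continuous g -> continuous (fun w => (f w, g w)).
Proof. by move=> cf cg w; apply: cvg_pair => /=; [exact: cf|exact: cg]. Qed.

Lemma fst_continuous (X Y : topologicalType) : continuous (@fst X Y).
Proof. by move=> ?; exact: cvg_fst. Qed.

Lemma snd_continuous (X Y : topologicalType) : continuous (@snd X Y).
Proof. by move=> ?; exact: cvg_snd. Qed.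

Lemma comp_continuous (X Y Z : topologicalType) (f : X -> Y) (g : Y -> Z) :
  continuous f -> continuous g -> continuous (g \o f).
Proof. by move=> cf cg x; apply: continuous_comp; [exact: cf|exact: cg]. Qed.

Lemma inl_continuous (X Y : topologicalType) : continuous (@inl X Y).
Proof. by apply/continuousP => U []. Qed.

Lemma inr_continuous (X Y : topologicalType) : continuous (@inr X Y).
Proof. by apply/continuousP => U []. Qed.

Lemma set_val_continuous (X : topologicalType) (A : set X) :
  continuous (set_val : A -> X).
Proof. exact: initial_continuous. Qed.

Definition incl (X : topologicalType) (A : set X) : continuousType A X :=
  mkcts (@set_val_continuous X A).

Section restriction.
Context {X Y : topologicalType} (A : set X) (B : set Y) (f : X -> Y).
Hypothesis fAB : A `<=` f @^-1` B.

Definition restr_fun (x : A) : B :=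
  exist _ (f (set_val x)) (mem_set (fAB (set_valP x))).

Lemma restr_continuous : continuous f -> continuous restr_fun.
Proof.
move=> cf; apply: continuous_comp_initial.
by apply: comp_continuous cf; exact: set_val_continuous.
Qed.

Definition restr (cf : continuous f) : continuousType A B :=
  mkcts (restr_continuous cf).

End restriction.

End continuous_maps.

(** * Singular cohomology of pairs *)

Section simplices.
Context {RR : realType}.

Definition std_simplex (n : nat) : set 'rV[RR]_n.+1 :=
  [set t | (forall i, 0 <= t ord0 i) /\ \sum_i t ord0 i = 1].

Definition face_row n (i : 'I_n.+2) (t : 'rV[RR]_n.+1) : 'rV[RR]_n.+2 :=
  \row_j oapp (t ord0) 0 (unlift i j).

Lemma face_row_simplex n (i : 'I_n.+2) :
  @std_simplex n `<=` face_row i @^-1` @std_simplex n.+1.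
Proof.
move=> t [t0 t1]; split=> [j|]; first by rewrite mxE; case: unliftP => /=.
rewrite (bigD1_ord i) //= mxE unlift_none /= add0r -t1.
by apply: eq_bigr => j _; rewrite mxE liftK.
Qed.

Lemma face_row_continuous n (i : 'I_n.+2) : continuous (@face_row n i).
Proof.
move=> t U [P Pt PU].
pose Q (a : 'I_1) (j : 'I_n.+1) := P ord0 (lift i j).
exists Q => [a j|s Qs].
  by have := Pt ord0 (lift i j); rewrite mxE liftK /= (ord1 a).
apply: PU => a j; rewrite (ord1 a) mxE; case: unliftP => [k ->|->] /=.
  exact: Qs.
by have := Pt ord0 i; rewrite mxE unlift_none => /nbhs_singleton.
Qed.

Definition face n (i : 'I_n.+2) :
    continuousType (@std_simplex n) (@std_simplex n.+1) :=
  restr (@face_row_simplex n i) (@face_row_continuous n i).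

Lemma face_face n (i : 'I_n.+3) (j : 'I_n.+2) (i' : 'I_n.+2) (j' : 'I_n.+3) :
  (j < i)%N -> i' = i.-1 :> nat -> j' = j :> nat ->
  ccomp (face j) (face i) = ccomp (face i') (face j').
Proof.
move=> ji Ei Ej; apply/continuousEP => t; apply: val_inj => /=.
apply/rowP => k; rewrite !mxE.
case: (unliftP i k) => [a /(congr1 val)/= ka|/(congr1 val)/= ka] /=;
case: (unliftP j' k) => [b /(congr1 val)/= kb|/(congr1 val)/= kb] /=;
rewrite ?mxE;
try (case: (unliftP j a) => [c /(congr1 val)/= ac|/(congr1 val)/= ac] /=);
try (case: (unliftP i' b)
  => [d /(congr1 val)/= bd|/(congr1 val)/= bd] /=) => //;
move: ka kb; rewrite ?ac ?bd /bump => ka kb //; try (exfalso; lia).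
by congr (val t ord0 _); apply: val_inj => /=; lia.
Qed.

End simplices.

(** ** Cochains *)

(* Pairs (X, A) with A a subset of X; maps of pairs send A into B. *)
Record spair := SPair { space :> topologicalType; part : set space }.
Arguments part : clear implicits.

Definition abs (X : topologicalType) := @SPair X set0.

Record spmap (P Q : spair) := SPMap {
  pfun :> continuousType P Q;
  pfunP : part P `<=` pfun @^-1` part Q
}.

Lemma abs_mapP (X : topologicalType) (P : spair) (f : continuousType X P) :
  part (abs X) `<=` f @^-1` part P.
Proof. by []. Qed.

Definition abs_map (X : topologicalType) (P : spair)
  (f : continuousType X P) : spmap (abs X) P := SPMap (@abs_mapP X P f).

Section cochains.
Context (RR : realType) (R : comPzRingType).

Definition simplex (n : nat) (X : topologicalType) :=
  continuousType (@std_simplex RR n) X.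

(* Arbitrary R-valued functions on singular simplices, i.e. Hom(C_n(X), R). *)
Definition cochain (n : nat) (X : topologicalType) := simplex n X -> R^o.

HB.instance Definition _ n X := GRing.Lmodule.on (cochain n X).

(* The dual of the chain differential, without extra sign. *)
Definition diff n X (c : cochain n X) : cochain n.+1 X :=
  fun s => \sum_(i < n.+2) (-1) ^+ i * c (ccomp (face i) s).

Definition cpull n (X Y : topologicalType)
  (f : continuousType X Y) (c : cochain n Y) :
  cochain n X := fun s => c (ccomp s f).

Lemma diff_linear n X : linear (@diff n X).
Proof.
move=> k b c; apply/funext => s.
rewrite /diff !fctE scaler_sumr -big_split /=; apply: eq_bigr => i _.
by rewrite mulrDr /= mulrCA.
Qed.

HB.instance Definition _ n X :=
  GRing.isLinear.Build R (cochain n X) (cochain n.+1 X) _ (@diff n X)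
    (@diff_linear n X).

Lemma cpull_linear n (X Y : topologicalType) (f : continuousType X Y) :
  linear (@cpull n X Y f).
Proof. by []. Qed.

HB.instance Definition _ n (X Y : topologicalType) (f : continuousType X Y) :=
  GRing.isLinear.Build R (cochain n Y) (cochain n X) _ (@cpull n X Y f)
    (@cpull_linear n X Y f).

Lemma ccompA (W X Y Z : topologicalType) (f : continuousType W X)
    (g : continuousType X Y) (h : continuousType Y Z) :
  ccomp (ccomp f g) h = ccomp f (ccomp g h).
Proof. exact/continuousEP. Qed.

Lemma diff_cpull n (X Y : topologicalType)
    (f : continuousType X Y) (c : cochain n Y) :
  diff (cpull f c) = cpull f (diff c).
Proof.
by apply/funext => s; apply: eq_bigr => i _; rewrite /cpull ccompA.
Qed.

Lemma cpull_comp n (X Y Z : topologicalType)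
    (f : continuousType X Y) (g : continuousType Y Z)
  (c : cochain n Z) : cpull f (cpull g c) = cpull (ccomp f g) c.
Proof. by apply/funext => s; rewrite /cpull ccompA. Qed.

Lemma diff_diff n X (c : cochain n X) : diff (diff c) = 0.
Proof.
apply/funext => s; rewrite [RHS]/= {1}/diff.
under eq_bigr => i _ do rewrite /diff mulr_sumr.
rewrite pair_big /= (bigID (fun p : 'I_n.+3 * 'I_n.+2 => (p.2 < p.1)%N)) /=.
rewrite addrC; apply/eqP; rewrite addr_eq0; apply/eqP.
pose up (p : 'I_n.+3 * 'I_n.+2) : 'I_n.+3 * 'I_n.+2 :=
  (inord p.2.+1, inord p.1).
pose dn (p : 'I_n.+3 * 'I_n.+2) : 'I_n.+3 * 'I_n.+2 :=
  (inord p.2, inord p.1.-1).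
rewrite (reindex_onto dn up) /=; last first.
  move=> [i j]; rewrite /= -leqNgt => ij; rewrite /dn /up /=.
  have := ltn_ord i; have := ltn_ord j => jn i_n.
  rewrite !inordK //; last by lia.
  by congr pair; apply: val_inj; rewrite /= !inordK //; lia.
rewrite -sumrN /=; apply: eq_big => [[i j]|[i j]] /=.
  rewrite /dn /up /=; have := ltn_ord i; have := ltn_ord j => jn i_n.
  apply/idP/idP.
    case/andP => + /eqP [] /(congr1 val) /= + /(congr1 val) /=.
    by rewrite -leqNgt !inordK //; lia.
  move=> ji; apply/andP; split; first by rewrite -leqNgt !inordK //; lia.
  by apply/eqP; congr pair; apply: val_inj; rewrite /= !inordK //; lia.
rewrite /dn /up /= => /andP[+ /eqP [] /(congr1 val) /= + /(congr1 val) /=].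
have := ltn_ord i; have := ltn_ord j => jn i_n.
rewrite -leqNgt !inordK; try lia.
move=> ji iE _; rewrite -!ccompA.
rewrite (@face_face _ _ i j (inord i.-1) (inord j)) ?inordK; try lia.
by rewrite -[in RHS]iE exprS mulN1r mulNr opprK mulrCA.
Qed.

(* C^n(X, A) is the kernel of the restriction C^n(X) -> C^n(A). *)
Definition relative n (P : spair) (c : cochain n P) :=
  cpull (incl (part P)) c = 0.

Definition cocycle n (P : spair) : {pred cochain n P} :=
  fun c => `[< relative c /\ diff c = 0 >].

Lemma cocycleP n (P : spair) (c : cochain n P) :
  reflect (relative c /\ diff c = 0) (c \in @cocycle n P).
Proof. exact: asboolP. Qed.

Lemma cocycle_submod_closed n (P : spair) : submod_closed (@cocycle n P).
Proof.
split=> [|k b c]; rewrite !unfold_in.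
  by apply/asboolP; rewrite /relative !linear0.
move=> /asboolP[b0 db] /asboolP[c0 dc]; apply/asboolP; split.
  by rewrite /relative linearP /= b0 c0 scaler0 addr0.
by rewrite linearP /= db dc scaler0 addr0.
Qed.

HB.instance Definition _ n (P : spair) :=
  GRing.isSubmodClosed.Build R (cochain n P) (@cocycle n P)
    (@cocycle_submod_closed n P).

Definition cocycles n (P : spair) := {c : cochain n P | c \in @cocycle n P}.

Definition mk_cocycle n (P : spair) (c : cochain n P)
  (hc : c \in @cocycle n P) : cocycles n P := exist _ c hc.

HB.instance Definition _ n (P : spair) := [isSub of cocycles n P for @sval _ _].
HB.instance Definition _ n (P : spair) := [Choice of cocycles n P by <:].
HB.instance Definition _ n (P : spair) :=
  [SubChoice_isSubLmodule of cocycles n P by <:].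

Definition coboundary n (P : spair) : {pred cocycles n P} :=
  match n with
  | 0 => fun z => `[< val z = 0 >]
  | m.+1 => fun z => `[< exists2 b : cochain m P, relative b & diff b = val z >]
  end.

Lemma coboundary_submod_closed n (P : spair) : submod_closed (@coboundary n P).
Proof.
case: n => [|n]; split=> [|k y z]; rewrite !unfold_in.
- exact/asboolP.
- by move=> /asboolP y0 /asboolP z0; apply/asboolP;
    rewrite linearP /= y0 z0 scaler0 addr0.
- by apply/asboolP; exists 0; rewrite /relative linear0.
- move=> /asboolP[b rb db] /asboolP[c rc dc]; apply/asboolP.
  exists (k *: b + c); last by rewrite !linearP /= db dc.
  by rewrite /relative linearP /= rb rc scaler0 addr0.
Qed.

HB.instance Definition _ n (P : spair) :=
  GRing.isSubmodClosed.Build R (cocycles n P) (@coboundary n P)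
    (@coboundary_submod_closed n P).

(* H^n(X, A; R), relative cocycles modulo differentials of relative cochains,
   as an R-module; absolute cohomology is [coh RR R n (abs X)]. *)
Definition coh n (P : spair) := Quotient.quot (@coboundary n P).

HB.instance Definition _ n (P : spair) := GRing.Zmodule.on (coh n P).
HB.instance Definition _ n (P : spair) := Quotient.on (coh n P).

Definition cls n P (z : cocycles n P) : coh n P := \pi_(coh n P) z.

Lemma cls_eq n P (y z : cocycles n P) :
  cls y = cls z <-> y - z \in @coboundary n P.
Proof. by rewrite Quotient.idealrBE; split=> [/eqP|/eqP]. Qed.

Lemma cls_repr n P (x : coh n P) : cls (repr x) = x.
Proof. exact: reprK. Qed.

Lemma clsP n P (x : coh n P) : exists z, x = cls z.
Proof. by exists (repr x); rewrite cls_repr. Qed.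

Lemma clsD n P (y z : cocycles n P) : cls (y + z) = cls y + cls z.
Proof. exact: (Quotient.pi_add (@coboundary n P)). Qed.

Definition coh_scale n (P : spair) (k : R) (x : coh n P) : coh n P :=
  cls (k *: repr x).

Lemma coh_scale_cls n P k (z : cocycles n P) :
  coh_scale k (cls z) = cls (k *: z).
Proof.
by apply/cls_eq; rewrite -scalerBr; apply/rpredZ/cls_eq; rewrite cls_repr.
Qed.

Lemma coh_scaleA n P a b (x : coh n P) :
  coh_scale a (coh_scale b x) = coh_scale (a * b) x.
Proof. by have [z ->] := clsP x; rewrite !coh_scale_cls scalerA. Qed.

Lemma coh_scale0 n P (x : coh n P) : coh_scale 0 x = 0.
Proof.
have [z ->] := clsP x; rewrite coh_scale_cls scale0r.
by apply: (addrI (cls 0)); rewrite -clsD !addr0.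
Qed.

Lemma coh_scale1 n (P : spair) : left_id 1 (@coh_scale n P).
Proof. by move=> x; have [z ->] := clsP x; rewrite coh_scale_cls scale1r. Qed.

Lemma coh_scaleDr n (P : spair) : right_distributive (@coh_scale n P) +%R.
Proof.
move=> k x y; have [z ->] := clsP x; have [t ->] := clsP y.
by rewrite -clsD !coh_scale_cls -clsD scalerDr.
Qed.

Lemma coh_scaleDl n (P : spair) (x : coh n P) :
  {morph (@coh_scale n P)^~ x : a b / a + b}.
Proof.
move=> a b; have [z ->] := clsP x.
by rewrite !coh_scale_cls -clsD scalerDl.
Qed.

HB.instance Definition _ n (P : spair) :=
  GRing.Zmodule_isLmodule.Build R (coh n P) (@coh_scaleA n P)
    (@coh_scale1 n P) (@coh_scaleDr n P) (@coh_scaleDl n P).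

Lemma clsZ n P k (z : cocycles n P) : cls (k *: z) = k *: cls z.
Proof. by rewrite -coh_scale_cls. Qed.

(** ** Functoriality *)

Section functoriality.
Context {P Q : spair} (f : spmap P Q).

Lemma cpull_relative n (c : cochain n Q) :
  relative c -> relative (cpull f c : cochain n P).
Proof.
rewrite /relative => c0.
have fE : ccomp (incl (part P)) f =
    ccomp (restr (pfunP f) (@ccont _ _ f)) (incl (part Q)).
  exact/continuousEP.
by rewrite cpull_comp fE -cpull_comp c0 linear0.
Qed.

Lemma cpull_cocycle n (z : cocycles n Q) :
  (cpull f (val z) : cochain n P) \in @cocycle n P.
Proof.
have /cocycleP[z0 dz] := valP z; apply/(cocycleP (P:=P)); split.
  exact: cpull_relative.
by rewrite diff_cpull dz linear0.
Qed.

Definition cocycle_map n (z : cocycles n Q) : cocycles n P :=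
  mk_cocycle (cpull_cocycle z).

Lemma cocycle_map_linear n : linear (@cocycle_map n).
Proof. by move=> k y z; apply: val_inj; rewrite /= linearP. Qed.

HB.instance Definition _ n :=
  GRing.isLinear.Build R (cocycles n Q) (cocycles n P) _ (@cocycle_map n)
    (@cocycle_map_linear n).

Lemma cocycle_map_coboundary n (z : cocycles n Q) :
  z \in @coboundary n Q -> cocycle_map z \in @coboundary n P.
Proof.
case: n z => [|n] z; rewrite !unfold_in => /asboolP.
  by move=> z0; apply/asboolP; rewrite /= z0 linear0.
move=> [b rb db]; apply/asboolP; exists (cpull f b).
  exact: cpull_relative.
by rewrite diff_cpull db.
Qed.

Definition coh_map n (x : coh n Q) : coh n P := cls (cocycle_map (repr x)).

Lemma coh_map_cls n (z : cocycles n Q) :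
  coh_map (cls z) = cls (cocycle_map z).
Proof.
apply/cls_eq; rewrite -linearB; apply/cocycle_map_coboundary/cls_eq.
exact: cls_repr.
Qed.

Lemma coh_map_linear n : linear (@coh_map n).
Proof.
move=> k x y; have [z ->] := clsP x; have [t ->] := clsP y.
by rewrite -clsZ -clsD !coh_map_cls linearP clsD clsZ.
Qed.

HB.instance Definition _ n :=
  GRing.isLinear.Build R (coh n Q) (coh n P) _ (@coh_map n)
    (@coh_map_linear n).

End functoriality.

(** ** The connecting homomorphism *)

(* H^n(A) -> H^n.+1(X, A): differential of any extension to X of a cocycle on A
   (see [connecting_cls]); the definition uses the extension by zero. *)
Section connecting.
Context {P : spair}.

Definition extend0 n (c : cochain n (part P)) : cochain n P := fun s =>
  if pselect (exists t : simplex n (part P), ccomp t (incl (part P)) = s)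
  is left ex then c (projT1 (cid ex)) else 0.

Lemma incl_inj n : injective (fun t : simplex n (part P) =>
  ccomp t (incl (part P))).
Proof.
move=> t t' /continuousEP tt'; apply/continuousEP => x.
exact/val_inj/(tt' x).
Qed.

Lemma extend0K n (c : cochain n (part P)) :
  cpull (incl (part P)) (extend0 c) = c.
Proof.
apply/funext => t; rewrite /cpull /extend0.
case: pselect => [ex|[]]; last by exists t.
by case: (cid ex) => t' /= /incl_inj ->.
Qed.

Lemma connecting_cocycle n (z : cocycles n (abs (part P))) :
  diff (extend0 (val z)) \in @cocycle n.+1 P.
Proof.
have /cocycleP[_ dz] := valP z.
apply/(cocycleP (P:=P)); split; last exact: diff_diff.
by rewrite /relative -diff_cpull extend0K dz.
Qed.

Definition connecting n (x : coh n (abs (part P))) : coh n.+1 P :=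
  cls (mk_cocycle (connecting_cocycle (repr x))).

Lemma connecting_cls n (z : cocycles n (abs (part P)))
    (c : cochain n P) (hc : diff c \in @cocycle n.+1 P) :
  cpull (incl (part P)) c = val z ->
  connecting (cls z) = cls (mk_cocycle hc).
Proof.
move=> cz; apply/cls_eq.
have /cls_eq : cls (repr (cls z)) = cls z by rewrite cls_repr.
set y := repr _; move: y => y yz; rewrite unfold_in; apply/asboolP.
rewrite /=.
have [b bE] : exists b : cochain n P, diff b = 0 /\
  relative (extend0 (val y) - c - b).
  case: n z c {hc} cz y yz => [|n] z c cz y.
    rewrite unfold_in => /asboolP /= yz; exists 0.
    split; first by rewrite linear0.
    by rewrite subr0 /relative linearB /= extend0K cz.
  rewrite unfold_in => /asboolP /= [b _ yz]; exists (diff (extend0 b)).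
  split; first exact: diff_diff.
  by rewrite /relative !linearB /= -diff_cpull !extend0K cz yz subrr.
exists (extend0 (val y) - c - b); first by case: bE.
by rewrite !linearB /= bE.1 subr0.
Qed.

End connecting.

End cochains.

(** * Homotopy coequalisers *)

Section interval.
Context {RR : realType}.

Definition unit_itv : set RR := `[0, 1].

Lemma unit_itv0 : (0 : RR) \in unit_itv.
Proof. by rewrite inE /unit_itv /= in_itv /= lexx ler01. Qed.

Lemma unit_itv1 : (1 : RR) \in unit_itv.
Proof. by rewrite inE /unit_itv /= in_itv /= lexx ler01. Qed.

Definition I0 : unit_itv := exist _ 0 unit_itv0.
Definition I1 : unit_itv := exist _ 1 unit_itv1.

Lemma I1_neq0 : I1 != I0.
Proof. by apply/eqP => /(congr1 val)/eqP; rewrite /= oner_eq0. Qed.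

End interval.

Lemma sum_continuous (X Y Z : topologicalType) (h : X + Y -> Z) :
  continuous (h \o inl) -> continuous (h \o inr) -> continuous h.
Proof.
move=> /continuousP hl /continuousP hr; apply/continuousP => U oU.
by split; [exact: hl|exact: hr].
Qed.

(* The homotopy coequaliser of [f] and [g]: the quotient of Y x [0,1] + X by
   (y, 0) ~ g y and (y, 1) ~ f y. Each class has exactly one representative
   fixed by [hcoeq_nf], so the generated equivalence relation is equality of
   normal forms. *)
Section hcoeq.
Context (RR : realType) {X Y : topologicalType} (f g : Y -> X).

Notation I := (@unit_itv RR).

Definition hcoeq_nf (q : Y * I + X) : Y * I + X :=
  match q with
  | inl (y, t) =>
      if t == I1 then inr (f y) else if t == I0 then inr (g y) else q
  | inr _ => q
  end.

Definition hcoeq_rel : rel (Y * I + X) := relpre hcoeq_nf eq_op.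

Lemma hcoeq_rel_equiv : equiv_class_of hcoeq_rel.
Proof.
by split=> [q|q q'|q q' q'']; rewrite /hcoeq_rel /= ?eqxx// => /eqP-> /eqP->.
Qed.

Canonical hcoeq_equiv := EquivRelPack hcoeq_rel_equiv.
Canonical hcoeq_encModRel := defaultEncModRel hcoeq_rel.

Definition hcoeq := {eq_quot hcoeq_rel}.

HB.instance Definition _ := Topological.copy hcoeq (quotient_topology hcoeq).
HB.instance Definition _ := Quotient.on hcoeq.

Definition hcoeq_pi (q : Y * I + X) : hcoeq := \pi_hcoeq q.

Lemma hcoeq_pi_continuous : continuous hcoeq_pi.
Proof. exact: pi_continuous. Qed.

Lemma hcoeq_piP q q' : hcoeq_pi q = hcoeq_pi q' <-> hcoeq_nf q = hcoeq_nf q'.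
Proof. by split=> [/eqmodP/eqP|qq']; last exact/eqmodP/eqP. Qed.

Lemma hcoeq_repr q : hcoeq_pi (repr q) = q.
Proof. exact: reprK. Qed.

Lemma hcoeq_nf_repr q : hcoeq_nf (repr (hcoeq_pi q)) = hcoeq_nf q.
Proof. by apply/hcoeq_piP; rewrite hcoeq_repr. Qed.

Lemma hcoeq_nf_idem q : hcoeq_nf (hcoeq_nf q) = hcoeq_nf q.
Proof.
case: q => [[y t]|x] //=; case: ifPn => // t1; case: ifPn => // t0 /=.
by rewrite (negbTE t1) (negbTE t0).
Qed.

Lemma hcoeq_pi_nf_repr q : hcoeq_pi (hcoeq_nf (repr q)) = q.
Proof. by rewrite -[RHS]hcoeq_repr; apply/hcoeq_piP/hcoeq_nf_idem. Qed.

Definition hcoeq_base : continuousType X hcoeq :=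
  mkcts (comp_continuous (@inr_continuous (Y * I)%type X) hcoeq_pi_continuous).

Definition hcoeq_cyl : continuousType (Y * I)%type hcoeq :=
  mkcts (comp_continuous (@inl_continuous (Y * I)%type X) hcoeq_pi_continuous).

End hcoeq.

Section hcoeq_map.
Context (RR : realType) {X Y X' Y' : topologicalType}.
Context {f g : Y -> X} {f' g' : Y' -> X'}.
Context {u : Y -> Y'} {v : X -> X'}.
Hypotheses (vf : forall y, v (f y) = f' (u y)).
Hypotheses (vg : forall y, v (g y) = g' (u y)).

Notation I := (@unit_itv RR).

Definition hcoeq_lift (q : Y * I + X) : Y' * I + X' :=
  match q with inl yt => inl (u yt.1, yt.2) | inr x => inr (v x) end.

Definition hcoeq_map (q : hcoeq RR f g) : hcoeq RR f' g' :=
  hcoeq_pi f' g' (hcoeq_lift (repr q)).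

Lemma hcoeq_lift_nf q :
  hcoeq_nf f' g' (hcoeq_lift (hcoeq_nf f g q)) =
  hcoeq_nf f' g' (hcoeq_lift q).
Proof.
case: q => [[y t]|x] //=.
by case: ifPn => [_|t1] /=; rewrite ?vf//; case: ifPn => [_|t0] /=;
  rewrite ?vg // (negbTE t1) (negbTE t0).
Qed.

Lemma hcoeq_map_pi q :
  hcoeq_map (hcoeq_pi f g q) = hcoeq_pi f' g' (hcoeq_lift q).
Proof.
by apply/hcoeq_piP; rewrite -hcoeq_lift_nf hcoeq_nf_repr hcoeq_lift_nf.
Qed.

Lemma hcoeq_map_continuous :
  continuous u -> continuous v -> continuous hcoeq_map.
Proof.
move=> cu cv; apply/quotient_continuous.
have -> : hcoeq_map \o \pi_(quotient_topology (hcoeq RR f g)) =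
    hcoeq_pi f' g' \o hcoeq_lift by apply/funext => q; exact: hcoeq_map_pi.
apply: comp_continuous (@hcoeq_pi_continuous _ _ _ _ _).
apply: sum_continuous.
  apply: comp_continuous (@inl_continuous _ _).
  apply: pair_continuous; last exact: snd_continuous.
  exact: comp_continuous (@fst_continuous _ _) cu.
exact: comp_continuous cv (@inr_continuous _ _).
Qed.

Definition hcoeq_cmap (cu : continuous u) (cv : continuous v) :
    continuousType (hcoeq RR f g) (hcoeq RR f' g') :=
  mkcts (hcoeq_map_continuous cu cv).

End hcoeq_map.

Arguments hcoeq_lift {RR X Y X' Y'} u v q.
Arguments hcoeq_map {RR X Y X' Y' f g f' g'} u v q.

Section suspension.
Context (RR : realType) (Y : topologicalType).

Notation I := (@unit_itv RR).
Definition point_space := discrete_topology unit.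

Definition to_point (X : topologicalType) (x : X) : point_space := tt.

Lemma to_point_continuous (X : topologicalType) : continuous (@to_point X).
Proof. by move=> x; exact: cvg_cst. Qed.

(* The reduced suspension of Y_+ = Y + point, that is Y x [0,1] with
   Y x {0, 1} collapsed to the base point. *)
Definition susp := hcoeq RR (@to_point Y) (@to_point Y).
Definition susp_point : susp := hcoeq_base RR (@to_point Y) (@to_point Y) tt.
Definition susp_pair := @SPair susp [set susp_point].

Definition cyl_ends : set (Y * I) := [set q | q.2 = I0 \/ q.2 = I1].
Definition cyl_pair := SPair cyl_ends.

Lemma cyl_collapse_ends :
  part cyl_pair `<=`
  hcoeq_cyl RR (@to_point Y) (@to_point Y) @^-1` part susp_pair.
Proof.
move=> [y t] [] /= ->; apply/hcoeq_piP; rewrite /hcoeq_nf ?eqxx //.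
by rewrite eq_sym (negbTE I1_neq0).
Qed.

Definition cyl_collapse : spmap cyl_pair susp_pair :=
  SPMap cyl_collapse_ends.

Lemma end_subproof (t : I) (y : Y) : t = I0 \/ t = I1 -> (y, t) \in cyl_ends.
Proof. by move=> tE; rewrite inE. Qed.

Definition end_fun (t : I) (tE : t = I0 \/ t = I1) (y : Y) : cyl_ends :=
  exist _ (y, t) (end_subproof y tE).

Lemma end_continuous t (tE : t = I0 \/ t = I1) : continuous (end_fun tE).
Proof.
apply: continuous_comp_initial; apply: pair_continuous => [y|y].
  exact: cvg_id.
exact: cvg_cst.
Qed.

Definition end0 : continuousType Y cyl_ends :=
  mkcts (@end_continuous I0 (or_introl erefl)).
Definition end1 : continuousType Y cyl_ends :=
  mkcts (@end_continuous I1 (or_intror erefl)).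

End suspension.

Arguments cyl_ends : clear implicits.

Definition pull (RR : realType) (R : comPzRingType) n (X Y : topologicalType)
    (f : continuousType X Y) (x : coh RR R n (abs Y)) : coh RR R n (abs X) :=
  coh_map (abs_map (P := abs Y) f) x.

Section hcoeq_delta.
Context {RR : realType} {R : comPzRingType} {X Y : topologicalType}.

(* The graph of the suspension isomorphism H^n(Y) -> H^n.+1(susp Y, point).
   Under the (excision) isomorphism with H^n.+1(Y x [0,1], Y x {0, 1}), the
   class c is sent to the connecting homomorphism applied to the class equal to
   c on Y x {1} and to 0 on Y x {0}. This choice of sign is the one for which
   H^n(X) -> H^n(Y) in the long exact sequence of the homotopy coequaliser (the
   connecting homomorphism of the pair (hcoeq f g, X)) is f^* - g^*. *)
Definition suspends n (c : coh RR R n (abs Y))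
    (s : coh RR R n.+1 (susp_pair RR Y)) : Prop :=
  exists b : coh RR R n (abs (cyl_ends RR Y)),
    [/\ pull (end1 RR Y) b = c,
        pull (end0 RR Y) b = 0 &
        coh_map (cyl_collapse RR Y) s = connecting (P := cyl_pair RR Y) b].

Definition collapse (f g : Y -> X) :
    spmap (abs (hcoeq RR f g)) (susp_pair RR Y) :=
  abs_map (hcoeq_cmap RR (f := f) (g := g) (f' := @to_point Y)
    (g' := @to_point Y) (u := idfun) (v := @to_point X) (fun=> erefl)
    (fun=> erefl) (fun y => @cvg_id _ _) (@to_point_continuous X)
    : continuousType _ (susp_pair RR Y)).

(* [e] is the image of [c] under H^n(Y) -> H^n.+1(hcoeq f g). *)
Definition hcoeq_delta (f g : Y -> X) n (c : coh RR R n (abs Y))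
    (e : coh RR R n.+1 (abs (hcoeq RR f g))) : Prop :=
  exists2 s, suspends c s & e = coh_map (collapse f g) s.

End hcoeq_delta.

(** * Vector bundles, orientations, Thom and Euler classes *)

(* A continuous family of vector spaces with its zero section. [vadd] is only
   meaningful on pairs of vectors of the same fibre; the vector space axioms of
   the fibres follow from local triviality. *)
Record vfamily (RR : realType) (X : topologicalType) := VFamily {
  tot : topologicalType;
  proj : continuousType tot X;
  zsec : continuousType X tot;
  vadd : tot -> tot -> tot;
  vscale : RR -> tot -> tot;
  proj_zsec : forall x, proj (zsec x) = x;
  proj_add : forall e e', proj e = proj e' -> proj (vadd e e') = proj e;
  proj_scale : forall a e, proj (vscale a e) = proj e
}.

(* e |-> (proj e, h e) is a homeomorphism from the preimage of U to
   U x RR^r with inverse k, linear on each fibre. *)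
Record trivialization (RR : realType) (X : topologicalType) (r : nat)
    (E : vfamily RR X) (U : set X) (h : tot E -> 'rV[RR]_r)
    (k : X -> 'rV[RR]_r -> tot E) : Prop := {
  triv_continuous : {within proj E @^-1` U, continuous h};
  triv_inv_continuous :
    {within U `*` setT, continuous (fun q : X * 'rV[RR]_r => k q.1 q.2)};
  trivK : forall e, U (proj E e) -> k (proj E e) (h e) = e;
  triv_proj : forall x v, U x -> proj E (k x v) = x;
  trivKV : forall x v, U x -> h (k x v) = v;
  triv_zsec : forall x, U x -> h (zsec E x) = 0;
  triv_add : forall e e', U (proj E e) -> proj E e = proj E e' ->
    h (vadd e e') = h e + h e';
  triv_scale : forall a e, U (proj E e) -> h (vscale a e) = a *: h e
}.

Record vbundle (RR : realType) (X : topologicalType) (r : nat) := VBundle {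
  vfam :> vfamily RR X;
  locally_trivial : forall x, exists U h k,
    [/\ open U, U x & @trivialization RR X r vfam U h k]
}.

Definition sp_id (P : spair) : spmap P P := @SPMap P P idfun (fun _ h => h).

Definition rpair (P : spair) (A : set P) : spair :=
  @SPair A (set_val @^-1` part P).

Definition rincl (P : spair) (A : set P) : spmap (rpair A) P :=
  @SPMap (rpair A) P (incl A) (fun _ h => h).

Section rmap.
Context {P Q : spair} (f : spmap P Q) (A : set P) (B : set Q).
Hypothesis fAB : A `<=` f @^-1` B.

Definition rmap_fun : continuousType (rpair A) (rpair B) :=
  restr fAB (@ccont _ _ f).

Lemma rmap_part : part (rpair A) `<=` rmap_fun @^-1` part (rpair B).
Proof. by move=> x Ax; apply: (pfunP f). Qed.

Definition rmap : spmap (rpair A) (rpair B) := SPMap rmap_part.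

End rmap.

Section thom.
Context {RR : realType} {R : comPzRingType} {X : topologicalType}.
Implicit Type E : vfamily RR X.

Definition nonzero E : set (tot E) := ~` range (zsec E).
Arguments nonzero : clear implicits.
Definition tot0 E : topologicalType := nonzero E.
Definition proj0 E : continuousType (tot0 E) X :=
  ccomp (incl (nonzero E)) (proj E).

Definition tot_pair E : spair := SPair (nonzero E).
(* (p^-1 U, p^-1 U minus the zero section) *)
Definition over E (U : set X) : spair :=
  rpair (P := tot_pair E) (proj E @^-1` U).
Definition fiber E (x : X) : spair := over E [set x].

Lemma fiber_over_subproof E (U : set X) x : U x ->
  proj E @^-1` [set x] `<=` sp_id (tot_pair E) @^-1` (proj E @^-1` U).
Proof. by move=> Ux e /= ->. Qed.

Definition fiber_over E (U : set X) x (Ux : U x) :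
    spmap (fiber E x) (over E U) :=
  @rmap (tot_pair E) (tot_pair E) _ _ _ (@fiber_over_subproof E U x Ux).

(* A generator of H^r(E_x, E_x \ 0; R) for each x, locally induced by a class
   of the bundle restricted to a neighbourhood. *)
Record orientation (r : nat) E := Orientation {
  ofiber :> forall x, coh RR R r (fiber E x);
  ofiber_gen : forall x (c : coh RR R r (fiber E x)),
    exists k : R, c = k *: ofiber x;
  ofiber_loc : forall x, exists2 U : set X, open U /\ U x &
    exists c : coh RR R r (over E U),
      forall y (Uy : U y), coh_map (fiber_over E Uy) c = ofiber y
}.

(* "The" Thom class and "the" Euler class are characterised by predicates, so
   that the Thom isomorphism theorem is not needed to state anything. *)
Definition is_thom_class r E (o : orientation r E)
    (u : coh RR R r (tot_pair E)) : Prop :=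
  forall x, coh_map (rincl (P := tot_pair E) (proj E @^-1` [set x])) u = o x.

Definition is_euler_class r E (o : orientation r E)
    (e : coh RR R r (abs X)) : Prop :=
  exists2 u, is_thom_class o u &
    e = coh_map (abs_map (zsec E : continuousType X (tot_pair E))) u.

Definition is_secondary_thom_class n E (o : orientation n.+1 E)
    (a : coh RR R n (abs (tot0 E))) : Prop :=
  is_thom_class o (connecting (P := tot_pair E) a).

End thom.

Arguments nonzero {RR X} E.

Section fiber_map.
Context {RR : realType} {X X' : topologicalType}.
Context {E : vfamily RR X} {E' : vfamily RR X'}.
Context (f : spmap (tot_pair E) (tot_pair E')) (x : X) (x' : X').
Hypothesis fxx' : forall e, proj E e = x -> proj E' (f e) = x'.

Definition fiber_map : spmap (fiber E x) (fiber E' x') :=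
  @rmap (tot_pair E) (tot_pair E') f (proj E @^-1` [set x])
    (proj E' @^-1` [set x']) fxx'.

End fiber_map.

(** * Equivariant bundles and naive homotopy quotients *)

Record gaction (G : topologicalGroupType) (X : topologicalType) := GAction {
  gact :> G -> X -> X;
  gact_continuous : continuous (fun gx : G * X => gact gx.1 gx.2);
  gact1 : forall x, gact 1%g x = x;
  gactM : forall g h x, gact (g * h)%g x = gact g (gact h x)
}.

Definition act_map (G : topologicalGroupType) (X : topologicalType)
  (a : gaction G X) : continuousType (G * X)%type X :=
  mkcts (@gact_continuous _ _ a).

Definition pr2 (G X : topologicalType) : continuousType (G * X)%type X :=
  mkcts (@snd_continuous G X).

Record equivariant (RR : realType) (G : topologicalGroupType)
    (X : topologicalType) (a : gaction G X) (E : vfamily RR X) := Equivariant {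
  tact :> gaction G (tot E);
  tact_proj : forall g e, proj E (tact g e) = a g (proj E e);
  tact_add : forall g e e', proj E e = proj E e' ->
    tact g (vadd e e') = vadd (tact g e) (tact g e');
  tact_scale : forall g k e, tact g (vscale k e) = vscale k (tact g e)
}.

Section equivariant.
Context {RR : realType} {G : topologicalGroupType} {X : topologicalType}.
Context {r : nat} {E : vbundle RR X r} {a : gaction G X}.
Context (A : equivariant a E).

Lemma zsecE (e : tot E) : zsec E (proj E e) = vscale 0 e.
Proof.
have [U [h [k [_ Ux T]]]] := locally_trivial E (proj E e).
have Ue' : U (proj E (vscale 0 e)) by rewrite proj_scale.
have Ue : U (proj E (zsec E (proj E e))) by rewrite proj_zsec.
rewrite -(trivK T Ue) -(trivK T Ue') proj_zsec proj_scale.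
by rewrite (triv_zsec T)// (triv_scale T)// scale0r.
Qed.

Lemma tact_zsec g x : A g (zsec E x) = zsec E (a g x).
Proof.
have := zsecE (zsec E x); rewrite proj_zsec => ->.
by rewrite tact_scale -zsecE tact_proj proj_zsec.
Qed.

Lemma tact_nonzero g e : nonzero E e -> nonzero E (A g e).
Proof.
move=> e0 [x _ xe]; apply: e0; exists (a g^-1%g x) => //.
by rewrite -tact_zsec xe -gactM mulVg gact1.
Qed.

Definition act0 (g : G) (e : tot0 E) : tot0 E :=
  exist _ (A g (set_val e)) (mem_set (@tact_nonzero g _ (set_valP e))).

Lemma act0_continuous : continuous (fun ge : G * tot0 E => act0 ge.1 ge.2).
Proof.
apply: continuous_comp_initial => /=.
apply: (@comp_continuous _ _ _ (fun ge : G * tot0 E => (ge.1, set_val ge.2)) _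
  _ (@gact_continuous _ _ A)).
apply: pair_continuous; first exact: fst_continuous.
exact: comp_continuous (@snd_continuous _ _) (@set_val_continuous _ _).
Qed.

Lemma act0_1 e : act0 1%g e = e.
Proof. by apply: val_inj; rewrite /= gact1. Qed.

Lemma act0_M g h e : act0 (g * h)%g e = act0 g (act0 h e).
Proof. by apply: val_inj; rewrite /= gactM. Qed.

(* The restriction of the action to the complement of the zero section. *)
Definition tact0 : gaction G (tot0 E) := GAction act0_continuous act0_1 act0_M.

Lemma tact_continuous g : continuous (A g).
Proof.
apply: (@comp_continuous _ _ _ (fun e : tot E => (g, e)) _
  _ (@gact_continuous _ _ A)).
by apply: pair_continuous => e; [exact: cvg_cst|exact: cvg_id].
Qed.

Definition tact_pmap g : spmap (tot_pair E) (tot_pair E) :=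
  @SPMap (tot_pair E) (tot_pair E) (mkcts (@tact_continuous g))
    (@tact_nonzero g).

Lemma tact_fiber g x (e : tot E) :
  proj E e = x -> proj E (tact_pmap g e) = a g x.
Proof. by move=> <-; exact: tact_proj. Qed.

Definition preserves_orientation (R : comPzRingType) n
    (o : orientation (R := R) n E) : Prop :=
  forall g x, coh_map (fiber_map (@tact_fiber g x)) (o (a g x)) = o x.

End equivariant.

(* (g, x, 0) ~ x and (g, x, 1) ~ g x *)
Definition nG (RR : realType) (G : topologicalGroupType) (X : topologicalType)
  (a : gaction G X) : topologicalType := hcoeq RR (act_map a) (@pr2 G X).

Section nG_bundle.
Context {RR : realType} {G : topologicalGroupType} {X : topologicalType}.
Context {r : nat} {E : vbundle RR X r} {a : gaction G X}.
Context (A : equivariant a E).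

Notation I := (@unit_itv RR).
Notation T := ((G * tot E) * I + tot E)%type.
Notation nf := (hcoeq_nf (act_map A) (@pr2 G (tot E))).
Notation pi := (hcoeq_pi (act_map A) (@pr2 G (tot E))).

Definition id_times (Y Z : topologicalType) (f : continuousType Y Z)
  (gy : G * Y) : G * Z := (gy.1, f gy.2).

Lemma id_times_continuous (Y Z : topologicalType) (f : continuousType Y Z) :
  continuous (id_times f).
Proof.
apply: pair_continuous; first exact: fst_continuous.
exact: comp_continuous (@snd_continuous _ _) (@ccont _ _ f).
Qed.

Lemma nG_proj_act (ge : G * tot E) :
  proj E (act_map A ge) = act_map a (id_times (proj E) ge).
Proof. exact: tact_proj. Qed.

Lemma nG_zsec_act (gx : G * X) :
  zsec E (act_map a gx) = act_map A (id_times (zsec E) gx).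
Proof. by rewrite /= -(tact_zsec A). Qed.

Definition nG_tot : topologicalType := nG RR A.

Definition nG_proj : continuousType nG_tot (nG RR a) :=
  hcoeq_cmap RR nG_proj_act (fun=> erefl) (@id_times_continuous _ _ (proj E))
    (@ccont _ _ (proj E)).

Definition nG_zsec : continuousType (nG RR a) nG_tot :=
  hcoeq_cmap RR nG_zsec_act (fun=> erefl) (@id_times_continuous _ _ (zsec E))
    (@ccont _ _ (zsec E)).

Lemma nG_proj_pi q : nG_proj (pi q) =
  hcoeq_pi (act_map a) (@pr2 G X) (hcoeq_lift (id_times (proj E)) (proj E) q).
Proof. exact: (hcoeq_map_pi nG_proj_act). Qed.

Lemma nG_zsec_pi q : nG_zsec (hcoeq_pi (act_map a) (@pr2 G X) q) =
  pi (hcoeq_lift (id_times (zsec E)) (zsec E) q).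
Proof. exact: (hcoeq_map_pi nG_zsec_act). Qed.

Lemma nG_proj_zsec q : nG_proj (nG_zsec q) = q.
Proof.
rewrite -(hcoeq_repr q) nG_zsec_pi nG_proj_pi; congr hcoeq_pi.
by case: (repr q) => [[[g x] t]|x] /=; rewrite /id_times /= proj_zsec.
Qed.

Definition nG_lift_add (q q' : T) : T :=
  match q, q' with
  | inl (ge, t), inl (ge', _) => inl ((ge.1, vadd ge.2 ge'.2), t)
  | inr e, inr e' => inr (vadd e e')
  | _, _ => q
  end.

Definition nG_add (q q' : nG_tot) : nG_tot :=
  pi (nG_lift_add (nf (repr q)) (nf (repr q'))).

Lemma nG_proj_add q q' :
  nG_proj q = nG_proj q' -> nG_proj (nG_add q q') = nG_proj q.
Proof.
rewrite /nG_add; set x := nf (repr q); set x' := nf (repr q').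
have -> : q = pi x by rewrite hcoeq_pi_nf_repr.
have -> : q' = pi x' by rewrite hcoeq_pi_nf_repr.
have : nf x = x by exact: hcoeq_nf_idem.
have : nf x' = x' by exact: hcoeq_nf_idem.
rewrite !nG_proj_pi.
move: x x' => [[[g e] t]|e] [[[g' e'] t']|e'] //= x'x' xx /hcoeq_piP /=.
  move: xx x'x'; case: ifP => // _; case: ifP => // _ _.
  case: ifP => // _; case: ifP => // _ _ [_ pe _].
  by rewrite /id_times /= proj_add.
by move=> [pe]; rewrite proj_add.
Qed.

Lemma nG_scale_act k (ge : G * tot E) :
  vscale k (act_map A ge) = act_map A (ge.1, vscale k ge.2).
Proof. by rewrite /= -tact_scale. Qed.

Definition nG_scale (k : RR) : nG_tot -> nG_tot :=

  hcoeq_map (fun ge => (ge.1, vscale k ge.2)) (vscale k).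

Lemma nG_proj_scale k q : nG_proj (nG_scale k q) = nG_proj q.
Proof.
rewrite -(hcoeq_repr q).
rewrite [nG_scale _ _](hcoeq_map_pi (@nG_scale_act k) (fun=> erefl)).
rewrite !nG_proj_pi; congr hcoeq_pi.
by case: (repr q) => [[[g e] t]|e] /=; rewrite /id_times /= proj_scale.
Qed.

(* The bundle E_nG over X_nG, with total space (Tot E)_nG. Its Thom and Euler
   classes only involve the projection, the zero section and the fibres. *)
Definition nG_family : vfamily RR (nG RR a) := {|
  tot := nG_tot;
  proj := nG_proj;
  zsec := nG_zsec;
  vadd := nG_add;
  vscale := nG_scale;
  proj_zsec := nG_proj_zsec;
  proj_add := nG_proj_add;
  proj_scale := nG_proj_scale
|}.

Definition nG_base : continuousType (tot E) nG_tot :=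
  hcoeq_base RR (act_map A) (@pr2 G (tot E)).

Lemma cyl_at_continuous g (t : I) :
  continuous (fun e : tot E => ((g, e), t) : (G * tot E) * I).
Proof.
apply: pair_continuous => [|e]; last exact: cvg_cst.
by apply: pair_continuous => e; [exact: cvg_cst|exact: cvg_id].
Qed.

Definition nG_cyl (g : G) (t : I) : continuousType (tot E) nG_tot :=
  ccomp (mkcts (@cyl_at_continuous g t))
    (hcoeq_cyl RR (act_map A) (@pr2 G (tot E))).

Definition zero_repr (q : T) : Prop :=
  range (zsec E) (match q with inl (ge, _) => ge.2 | inr e => e end).

Lemma zero_repr_nf q : zero_repr (nf q) <-> zero_repr q.
Proof.
case: q => [[[g e] t]|e] //; rewrite /zero_repr /=; case: ifP => _.
  split=> [ge|[x _ <-]]; last by exists (a g x); rewrite // -(tact_zsec A).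
  by apply: contrapT => /(@tact_nonzero _ _ _ _ _ _ A g).
by case: ifP.
Qed.

Lemma range_nG_zsec q : range nG_zsec (pi q) -> zero_repr q.
Proof.
move=> [y _]; rewrite -(hcoeq_repr y) nG_zsec_pi => /hcoeq_piP yq.
apply/zero_repr_nf; rewrite -yq; apply/zero_repr_nf; rewrite /zero_repr.
by case: (repr y) => [[[g x] t]|x] /=; exists x.
Qed.

Definition nG_base_pmap : spmap (tot_pair E) (tot_pair nG_family) :=
  @SPMap (tot_pair E) (tot_pair nG_family) nG_base
    (fun e e0 ze => e0 (range_nG_zsec ze)).

Definition nG_cyl_pmap (g : G) (t : I) :
    spmap (tot_pair E) (tot_pair nG_family) :=
  @SPMap (tot_pair E) (tot_pair nG_family) (nG_cyl g t)
    (fun e e0 ze => e0 (range_nG_zsec ze)).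

Lemma nG_base_fiber x (e : tot E) : proj E e = x ->
  proj nG_family (nG_base_pmap e) = hcoeq_base RR (act_map a) (@pr2 G X) x.
Proof. by move=> <-; exact: nG_proj_pi. Qed.

Lemma nG_cyl_fiber g t x (e : tot E) : proj E e = x ->
  proj nG_family (nG_cyl_pmap g t e) =
  hcoeq_cyl RR (act_map a) (@pr2 G X) ((g, x), t).
Proof. by move=> <-; exact: nG_proj_pi. Qed.

(* The fibres of E_nG over the classes of x and (g, x, t) are identified with
   the fibre of E at x by e |-> [e] and e |-> [(g, e, t)]. *)
Definition induced_orientation (R : comPzRingType)
    (o : orientation (R := R) r E) (o' : orientation (R := R) r nG_family) :
    Prop :=
  (forall x, coh_map (fiber_map (@nG_base_fiber x)) (o' _) = o x) /\
  (forall g t x, coh_map (fiber_map (@nG_cyl_fiber g t x)) (o' _) = o x).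

End nG_bundle.

Section secondary_classes.
Context {RR : realType} {R : comPzRingType} {G : topologicalGroupType}.
Context {X : topologicalType} {n : nat} {E : vbundle RR X n.+1}.
Context {a : gaction G X} (A : equivariant a E).
Context (o : orientation (R := R) n.+1 E).

Definition nG_delta (c : coh RR R n (abs (G * X)%type)) :
    set (coh RR R n.+1 (abs (nG RR a))) :=
  hcoeq_delta (f := act_map a) (g := @pr2 G X) c.

Definition is_nG_euler_class (e : coh RR R n.+1 (abs (nG RR a))) : Prop :=
  exists2 o' : orientation (R := R) n.+1 (nG_family A),
    induced_orientation o o' & is_euler_class o' e.

Definition is_secondary_equivariant_euler_class
    (se : coh RR R n (abs (G * X)%type)) : Prop :=
  exists2 e, nG_delta se e & is_nG_euler_class e.

Definition id_p0 : continuousType (G * tot0 E)%type (G * X)%type :=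
  mkcts (@id_times_continuous G _ _ (proj0 E)).

(* The unique class d with (id x p_0)^* d = Phi^* a - P_2^* a. *)
Definition dPhi (aE : coh RR R n (abs (tot0 E))) :
    coh RR R n (abs (G * X)%type) :=
  xget 0 [set d | pull id_p0 d =
    pull (act_map (tact0 A)) aE - pull (@pr2 G (tot0 E)) aE].

End secondary_classes.

(* The submodule M_X of H^n(G x X). *)
Definition indeterminacy (RR : realType) (R : comPzRingType)
    (G : topologicalGroupType) (X : topologicalType) (a : gaction G X) n :
    set (coh RR R n (abs (G * X)%type)) :=
  range (fun m : coh RR R n (abs X) => pull (act_map a) m - pull (@pr2 G X) m).

Definition path_connected (RR : realType) (X : topologicalType) : Prop :=
  forall x y : X, exists g : continuousType (@unit_itv RR) X,
    g I0 = x /\ g I1 = y.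

(* Main.v *)
(* A simplex s of Tot E of dimension at most n, with rank E = n + 1, can be
   deformed within the fibres into Tot_0 E: over s the bundle is trivial, and a
   Lipschitz map from a k-simplex to RR^(n+1) with k <= n omits vectors
   arbitrarily close to 0, so that a small perturbation is nowhere zero. Doing
   this compatibly with faces shows, for an arbitrary base, that
   H^n(Y x Tot E, Y x Tot_0 E) = 0 and that a class in H^(n+1)(Tot E, Tot_0 E)
   is determined by its restrictions to the fibres.

   Let u be a cocycle representing the Thom class of E_nG. By uniqueness, its
   restriction to E is dh for a cochain h extending a cocycle of the secondary
   Thom class. If P denotes the prism operator and z the zero section, then
   D = Phi^* h - P_2^* h - P u is a cocycle on G x Tot E whose restriction to
   G x Tot_0 E is Phi^* a_E - P_2^* a_E, and so z^* D represents dPhi a_E.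
   Write z^* u = s + dc with s pulled back from the suspension. Then P s is
   cohomologous to se and P dc to phi^* c - p_2^* c, so that z^* D is
   cohomologous to - se + phi^* m - p_2^* m with m = z^* h - c. *)
Require Import Defs.
From HB Require Import structures.
From mathcomp Require Import all_boot all_order all_algebra.
From mathcomp Require Import zify ring lra.
From mathcomp Require Import all_classical all_reals topology normedtype.
From mathcomp Require Import derive numfun.

Set Implicit Arguments.
Unset Strict Implicit.
Unset Printing Implicit Defensive.

Import Order.TTheory GRing.Theory Num.Theory.
Import numFieldNormedType.Exports.
Import Defs.

Local Open Scope classical_set_scope.
Local Open Scope ring_scope.

(** * Continuity on rows and products *)

(** Over an arbitrary base there is no partition of unity and no fibre metric, so all geometry takes
    place over single simplices, where the bundle can be trivialized, and continuity on the total
    space is never asked of the deformation. The family [nG_family] comes without local triviality,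
    so uniqueness of Thom classes is applied to [E] alone. The class over the homotopy quotient
    enters only through its restriction to the base copy of [E] and through the cylinder over
    [G * tot E], which sends nonzero vectors to nonzero vectors; the latter is why the prism of u
    vanishes on [Tot_0]. The sign has the following origin. The prism formula gives the end 1 minus
    the end 0, that is, the action minus the projection. Closing up the difference of the two
    pullbacks of h therefore requires subtracting the prism of u, while a suspended class, placed at
    the end 1, has itself as prism with sign plus. The class [dPhi] is given by a choice among
    solutions, so it can be computed only by exhibiting a solution and knowing that solutions are
    unique. *)

Lemma rV_continuous (RR : realType) (T : topologicalType) n
    (f : T -> 'rV[RR]_n) :
  (forall j, continuous (fun t => f t ord0 j)) -> continuous f.
Proof.
move=> cf t U [P Pt PU].
have : \forall s \near t, forall j, P ord0 j (f s ord0 j).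
  by apply: filter_forall => j; apply: (cf j t); exact: Pt.
rewrite /= => H; rewrite /nbhs /=; apply: filterS H => s Ps.
by apply: PU => a j; rewrite (ord1 a).
Qed.

Lemma coord_cont (RR : realType) n (j : 'I_n) :
  continuous (fun t : 'rV[RR]_n => t ord0 j).
Proof. exact: coord_continuous. Qed.

Lemma continuous_sum (RR : realType) (T : topologicalType) (J : Type)
    (s : seq J) (p : pred J) (F : J -> T -> RR) :
  (forall j, continuous (F j)) ->
  continuous (fun t => \sum_(j <- s | p j) F j t).
Proof.
move=> cF; elim: s => [|j s IH] t.
  have -> : (fun t => \sum_(j <- [::] | p j) F j t) = fun=> 0.
    by apply/funext => u; rewrite big_nil.
  exact: cvg_cst.
have -> : (fun t => \sum_(j <- j :: s | p j) F j t) =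
    fun t => (if p j then F j t else 0) + \sum_(j <- s | p j) F j t.
  by apply/funext => u; rewrite big_cons; case: ifP; rewrite ?add0r.
apply: cvgD; last exact: IH.
by case: ifP => _; [exact: cF|exact: cvg_cst].
Qed.

Section continuous_arithmetic.
Context {RR : realType} {T : topologicalType} {V : normedModType RR}.
Implicit Types (f g : T -> V) (a b : T -> RR).

Lemma funD_continuous f g :
  continuous f -> continuous g -> continuous (fun x => f x + g x).
Proof. by move=> cf cg x; exact: cvgD (cf x) (cg x). Qed.

Lemma funB_continuous f g :
  continuous f -> continuous g -> continuous (fun x => f x - g x).
Proof. by move=> cf cg x; exact: cvgB (cf x) (cg x). Qed.

Lemma funM_continuous a b :
  continuous a -> continuous b -> continuous (fun x => a x * b x).
Proof. by move=> ca cb x; exact: cvgM (ca x) (cb x). Qed.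

Lemma funZ_continuous a f :
  continuous a -> continuous f -> continuous (fun x => a x *: f x).
Proof. by move=> ca cf x; exact: cvgZ (ca x) (cf x). Qed.

End continuous_arithmetic.

(** * The prism operator *)

Section prism.
Context {RR : realType}.
Notation I := (@unit_itv RR).
Notation Delta n := (@std_simplex RR n).

(** Barycentric coordinates are pushed forward along a vertex map by summing over its fibres.
    Encoding affine maps by data on vertices reduces the face identities of prisms to identities
    between functions on ordinals. *)
Definition vertex_row m k (phi : 'I_m.+1 -> 'I_k.+1) (x : 'rV[RR]_m.+1) :
  'rV[RR]_k.+1 := \row_j \sum_(l | phi l == j) x ord0 l.

Definition weight m (w : pred 'I_m.+1) (x : 'rV[RR]_m.+1) : RR :=
  \sum_(l | w l) x ord0 l.

Lemma vertex_row_simplex m k (phi : 'I_m.+1 -> 'I_k.+1) :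
  Delta m `<=` vertex_row phi @^-1` Delta k.
Proof.
move=> x [x0 x1]; split=> [j|]; first by rewrite mxE sumr_ge0.
rewrite -x1 [RHS](partition_big phi predT)//=.
by apply: eq_bigr => j _; rewrite mxE.
Qed.

Lemma weight_itv m (w : pred 'I_m.+1) : Delta m `<=` weight w @^-1` I.
Proof.
move=> x [x0 x1]; rewrite /unit_itv /= in_itv /= sumr_ge0//= -x1.
by rewrite [leRHS](bigID w)/= lerDl sumr_ge0.
Qed.

Lemma vertex_row_continuous m k (phi : 'I_m.+1 -> 'I_k.+1) :
  continuous (vertex_row phi).
Proof.
apply: rV_continuous => j; rewrite /vertex_row.
under eq_fun do rewrite mxE.
by apply: continuous_sum => l; exact: coord_cont.
Qed.

Lemma weight_continuous m (w : pred 'I_m.+1) : continuous (weight w).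
Proof. by apply: continuous_sum => l; exact: coord_cont. Qed.

(* The affine map of Delta^m to Delta^k x I sending the vertex l to
   (phi l, w l). *)
Definition affine_prism m k (phi : 'I_m.+1 -> 'I_k.+1) (w : pred 'I_m.+1) :
    continuousType (Delta m) (Delta k * I)%type :=
  mkcts (pair_continuous
    (@ccont _ _ (restr (@vertex_row_simplex m k phi)
      (@vertex_row_continuous m k phi)))
    (@ccont _ _ (restr (@weight_itv m w) (@weight_continuous m w)))).


Lemma sum_face_row k (j : 'I_k.+2) (p : pred 'I_k.+2) (x : 'rV[RR]_k.+1) :
  \sum_(l | p l) face_row j x ord0 l = \sum_(l | p (lift j l)) x ord0 l.
Proof.
rewrite big_mkcond (bigD1_ord j)//= mxE unlift_none /= if_same add0r.
rewrite [RHS]big_mkcond; apply: eq_bigr => l _.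
by rewrite mxE liftK.
Qed.

Lemma affine_prism_face m k (phi : 'I_m.+2 -> 'I_k.+1) w (j : 'I_m.+2) :
  ccomp (face j) (affine_prism phi w) =
  affine_prism (phi \o lift j) (w \o lift j).
Proof.
apply/continuousEP => x; congr pair; apply: val_inj => /=.
  by apply/rowP => i; rewrite !mxE sum_face_row.
by rewrite /weight sum_face_row.
Qed.

Definition cyl_map (Y Z : topologicalType) (f : continuousType Y Z) :
    continuousType (Y * I)%type (Z * I)%type :=
  mkcts (pair_continuous
    (comp_continuous (@fst_continuous Y I) (@ccont _ _ f))
    (@snd_continuous Y I)).

Definition cyl_incl (Z : topologicalType) (t : I) :
    continuousType Z (Z * I)%type :=
  mkcts (pair_continuous (fun z => @cvg_id _ _) (fun z => @cvg_cst _ t _ _ _)).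

Lemma face_affine_prism m k (phi : 'I_m.+1 -> 'I_k.+1) w (j : 'I_k.+2) :
  ccomp (affine_prism phi w) (cyl_map (face j)) =
  affine_prism (lift j \o phi) w.
Proof.
apply/continuousEP => x; congr pair; apply: val_inj => //=.
apply/rowP => i; rewrite !mxE; case: unliftP => [l ->|->] /=.
  by rewrite mxE; apply: eq_bigl => a /=; rewrite (inj_eq lift_inj).
by rewrite big_pred0// => a; rewrite /= eq_sym (negbTE (neq_lift _ _)).
Qed.

Lemma affine_prism_id m (b : bool) :
  affine_prism (@id 'I_m.+1) (fun=> b) =
  cyl_incl (Delta m) (if b then I1 else I0).
Proof.
apply/continuousEP => x; congr pair; apply: val_inj => /=.
  by apply/rowP => i; rewrite !mxE big_pred1_eq.
case: (set_valP x) => _ x1; rewrite /weight.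
by case: b; rewrite /= ?x1// big_pred0.
Qed.

Lemma eq_affine_prism m k (phi psi : 'I_m.+1 -> 'I_k.+1) w u :
  phi =1 psi -> w =1 u -> affine_prism phi w = affine_prism psi u.
Proof. by move=> /funext -> /funext ->. Qed.

End prism.

(* The cancellation pattern of the faces of the prism decomposition. *)
Lemma prism_sum (R : comPzRingType) (m : nat) (u v : nat -> nat -> R) :
  (forall i j, (j < i <= m.+1)%N -> u i j = v j i.-1) ->
  (forall i j, (i.+1 < j <= m.+2)%N -> u i j = v j.-1 i) ->
  (forall i, (i <= m)%N -> u i.+1 i.+1 = u i i.+1) ->
  \sum_(i < m.+2) (-1) ^+ i * (\sum_(j < m.+3) (-1) ^+ j * u i j) +
  \sum_(j < m.+2) (-1) ^+ j * (\sum_(i < m.+1) (-1) ^+ i * v j i) =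
  u 0%N 0%N - u m.+1 m.+2.
Proof.
move=> ult ugt udiag.
(* [w i j] is the signed term of the second double sum. In row i of the first one, the faces j < i
   and j > i + 1 give these terms with the opposite sign, and the two middle faces telescope by
   [udiag]. *)
pose w (i j : nat) : R := (-1) ^+ (i + j) * v j i.
have uE i : (i < m.+2)%N ->
    (-1) ^+ i * (\sum_(j < m.+3) (-1) ^+ j * u i j) =
    u i i - u i i.+1 - \sum_(0 <= j < i) w i.-1 j -
    \sum_(i.+1 <= j < m.+2) w i j.
  move=> im.
  rewrite -(big_mkord predT (fun j => (-1) ^+ j * u i j)).
  rewrite (@big_cat_nat _ _ _ i)//=; last lia.
  rewrite (@big_ltn _ _ _ i) 1?(@big_ltn _ _ _ i.+1)//; try lia.
  rewrite big_add1 /= !mulrDr.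
  have s2 : (-1) ^+ i * (-1) ^+ i = 1 :> R.
    by rewrite -exprMn mulrNN mulr1 expr1n.
  rewrite mulrA s2 mul1r exprS mulrA mulN1r mulrN s2 mulN1r.
  have -> : (-1) ^+ i * (\sum_(0 <= j < i) (-1) ^+ j * u i j) =
      - \sum_(0 <= j < i) w i.-1 j.
    rewrite mulr_sumr -sumrN; apply: eq_big_nat => j /andP[_ ji].
    rewrite /w ult; last lia.
    have -> : i = i.-1.+1 by lia.
    by rewrite /= mulrA -exprD addSn exprS mulN1r mulNr.
  have -> : (-1) ^+ i * (\sum_(i.+1 <= j < m.+2) (-1) ^+ j.+1 * u i j.+1) =
      - \sum_(i.+1 <= j < m.+2) w i j.
    rewrite mulr_sumr -sumrN; apply: eq_big_nat => j /andP[ij jm].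
    rewrite /w ugt /=; last lia.
    by rewrite mulrA -exprD addnS exprS mulN1r mulNr.
  by ring.
have -> : \sum_(j < m.+2) (-1) ^+ j * (\sum_(i < m.+1) (-1) ^+ i * v j i) =
    \sum_(0 <= i < m.+1) \sum_(0 <= j < m.+2) w i j.
  rewrite exchange_big_nat /= big_mkord; apply: eq_bigr => j _.
  rewrite mulr_sumr big_mkord; apply: eq_bigr => i _.
  by rewrite mulrA -exprD addnC.
under eq_bigr => i _ do rewrite uE//.
rewrite !sumrB -!(big_mkord predT (fun i => u i i)).
rewrite -(big_mkord predT (fun i => u i i.+1)).
rewrite -(big_mkord predT (fun i => \sum_(0 <= j < i) w i.-1 j)).
rewrite -(big_mkord predT (fun i => \sum_(i.+1 <= j < m.+2) w i j)).
have -> : \sum_(0 <= i < m.+2) u i i =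
    u 0%N 0%N + \sum_(0 <= i < m.+1) u i i.+1.
  rewrite big_nat_recl//; congr (_ + _).
  by apply: eq_big_nat => i /andP[_ im]; rewrite udiag.
rewrite (big_nat_recr m.+1 _ (fun i => u i i.+1))//=.
rewrite (big_nat_recl _ _ (fun i => \sum_(0 <= j < i) w i.-1 j))//=.
rewrite (big_nat_recr m.+1 _ (fun i => \sum_(i.+1 <= j < m.+2) w i j))//=.
rewrite [\sum_(0 <= j < 0) _]big_geq// [\sum_(m.+2 <= j < m.+2) _]big_geq//.
have -> : \sum_(0 <= i < m.+1) \sum_(0 <= j < m.+2) w i j =
    \sum_(0 <= i < m.+1) \sum_(0 <= j < i.+1) w i j +
    \sum_(0 <= i < m.+1) \sum_(i.+1 <= j < m.+2) w i j.
  rewrite -big_split /=; apply: eq_big_nat => i /andP[_ im].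
  by rewrite (@big_cat_nat _ _ _ i.+1)//=; lia.
rewrite ?addr0 ?add0r. ring.
Qed.

Section prism_operator.
Context {RR : realType} {R : comPzRingType}.
Notation I := (@unit_itv RR).
Notation Delta n := (@std_simplex RR n).

(** The classical piece with vertices 0, ..., i at height 0 followed by i, ..., k at height 1. For i
    at most k the argument of [inord] is in range, so its default never occurs. *)
Definition prism_piece k (i : nat) :
    continuousType (Delta k.+1) (Delta k * I)%type :=
  affine_prism (fun l : 'I_k.+2 => inord (unbump i l)) (fun l => (i < l)%N).

Definition prism k (Z : topologicalType)
    (c : cochain RR R k.+1 (Z * I)%type) : cochain RR R k Z :=
  fun s => \sum_(i < k.+1) (-1) ^+ i * c (ccomp (prism_piece k i) (cyl_map s)).

Lemma prism_linear k (Z : topologicalType) : linear (@prism k Z).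
Proof.
move=> a b c; apply/funext => s.
rewrite /prism !fctE scaler_sumr -big_split /=; apply: eq_bigr => i _.
by rewrite mulrDr /= mulrCA.
Qed.

HB.instance Definition _ k (Z : topologicalType) :=
  GRing.isLinear.Build R (cochain RR R k.+1 (Z * I)%type) (cochain RR R k Z) _
    (@prism k Z) (@prism_linear k Z).

Lemma cyl_map_comp (X Y Z : topologicalType) (f : continuousType X Y)
    (g : continuousType Y Z) :
  ccomp (cyl_map (RR := RR) f) (cyl_map g) = cyl_map (ccomp f g).
Proof. exact/continuousEP. Qed.

Lemma cyl_incl_map (Y Z : topologicalType) (f : continuousType Y Z) (t : I) :
  ccomp (cyl_incl Y t) (cyl_map f) = ccomp f (cyl_incl Z t).
Proof. exact/continuousEP. Qed.

Lemma prism_cpull k (Y Z : topologicalType) (f : continuousType Y Z)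
    (c : cochain RR R k.+1 (Z * I)%type) :
  prism (cpull (cyl_map f) c) = cpull f (prism c).
Proof.
apply/funext => s; apply: eq_bigr => i _.
by rewrite /cpull ccompA cyl_map_comp.
Qed.

(** Degree 0 is separate because [prism] lowers a positive degree: the term [diff (prism c)] is
    absent. *)
Lemma prism_diff0 (Z : topologicalType) (c : cochain RR R 0 (Z * I)%type) :
  prism (diff c) = cpull (cyl_incl Z I1) c - cpull (cyl_incl Z I0) c.
Proof.
apply/funext => s; rewrite /prism /diff big_ord1 expr0 mul1r.
rewrite !big_ord_recl big_ord0 /= expr0 mul1r expr1 mulN1r addr0.
rewrite -!ccompA /prism_piece !affine_prism_face /cpull !fctE.
rewrite -!cyl_incl_map -!(@affine_prism_id _ _ true) -(@affine_prism_id _ _ false).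
congr (_ - _); congr (c (ccomp _ _)); apply: eq_affine_prism => l //=;
  rewrite (ord1 l) //=; apply: val_inj => /=; rewrite inordK //.
Qed.

Lemma prism_diff k (Z : topologicalType) (c : cochain RR R k.+1 (Z * I)%type) :
  prism (diff c) + diff (prism c) =
  cpull (cyl_incl Z I1) c - cpull (cyl_incl Z I0) c.
Proof.
apply/funext => s; rewrite /prism /diff !fctE /cpull -!cyl_incl_map.
(* [u i j] is the face j of the piece i, and [v j i] is the piece i of the prism over the face j,
   both written for natural indices as [prism_sum] expects. *)
pose u (i j : nat) : R := c (ccomp (affine_prism
  (fun l : 'I_k.+2 => inord (unbump i (bump j l)))
  (fun l => (i < bump j l)%N)) (cyl_map s)).
pose v (j i : nat) : R := c (ccomp (affine_prism
  (fun l : 'I_k.+2 => inord (bump j (unbump i l)))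
  (fun l => (i < l)%N)) (cyl_map s)).
have E := @prism_sum R k u v.
transitivity (u 0%N 0%N - u k.+1 k.+2); last first.
  rewrite -(@affine_prism_id _ _ true) -(@affine_prism_id _ _ false) /u.
  congr (_ - _); congr (c (ccomp _ _)); apply: eq_affine_prism => l //=.
  - by apply: val_inj; rewrite /= /unbump /bump /= inordK; have := ltn_ord l; lia.
  - by apply: val_inj; rewrite /= /unbump /bump /= inordK; have := ltn_ord l; lia.
  - by rewrite /bump; have := ltn_ord l; lia.
rewrite -E; last 3 first.
- move=> i j ij; congr (c (ccomp _ _)); apply: eq_affine_prism => l /=.
    by congr inord; rewrite /bump /unbump; lia.
  by rewrite /bump; lia.
- move=> i j ij; congr (c (ccomp _ _)); apply: eq_affine_prism => l /=.
    by congr inord; rewrite /bump /unbump; lia.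
  by rewrite /bump; lia.
- move=> i im; congr (c (ccomp _ _)); apply: eq_affine_prism => l /=.
    by congr inord; rewrite /bump /unbump; lia.
  by rewrite /bump; lia.
congr (_ + _).
  apply: eq_bigr => i _; congr (_ * _); apply: eq_bigr => j _; congr (_ * _).
  by rewrite -ccompA affine_prism_face.
apply: eq_bigr => j _; congr (_ * _); apply: eq_bigr => i _; congr (_ * _).
rewrite -cyl_map_comp -ccompA face_affine_prism; congr (c (ccomp _ _)).
apply: eq_affine_prism => l //=; apply: val_inj => /=.
have := ltn_ord l; have := ltn_ord i; have := ltn_ord j => jk ik lk.
by rewrite !inordK // /bump /unbump; lia.
Qed.

End prism_operator.

(** * Exact cochains and homotopy invariance *)

Section exact_cochains.
Context {RR : realType} {R : comPzRingType}.
Notation I := (@unit_itv RR).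
Notation Delta n := (@std_simplex RR n).

(** The predicate [coboundary] transferred to bare cochains, so that classes are compared by cochain
    identities without packaging each term as a cocycle. *)
Definition exact_cochain n (P : spair) : cochain RR R n P -> Prop :=
  match n with
  | 0 => fun c => c = 0
  | m.+1 => fun c => exists2 b : cochain RR R m P, relative b & diff b = c
  end.

Lemma cls_eqP n (P : spair) (y z : cocycles RR R n P) :
  cls y = cls z <-> exact_cochain (val y - val z).
Proof.
rewrite cls_eq; case: n y z => [|n] y z; rewrite unfold_in /=;
  by split=> [/asboolP|H]; last exact/asboolP.
Qed.

Lemma exact_lin n (P : spair) k (b c : cochain RR R n P) :
  exact_cochain b -> exact_cochain c -> exact_cochain (k *: b + c).
Proof.
case: n b c => [|n] b c; first by move=> -> ->; rewrite scaler0 addr0.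
move=> [b' rb <-] [c' rc <-]; exists (k *: b' + c'); last by rewrite linearP.
by rewrite /relative linearP /= rb rc scaler0 addr0.
Qed.

Lemma exact0 n (P : spair) : exact_cochain (0 : cochain RR R n P).
Proof.
case: n => [//|n]; exists 0; last by rewrite linear0.
by rewrite /relative linear0.
Qed.

Lemma exactD n (P : spair) (b c : cochain RR R n P) :
  exact_cochain b -> exact_cochain c -> exact_cochain (b + c).
Proof. by move=> /(exact_lin 1) H /H; rewrite scale1r. Qed.

Lemma exactN n (P : spair) (b : cochain RR R n P) :
  exact_cochain b -> exact_cochain (- b).
Proof.
by move=> /(exact_lin (-1)) /(_ (exact0 _ _)); rewrite scaleN1r addr0.
Qed.

Lemma exactB n (P : spair) (b c : cochain RR R n P) :
  exact_cochain b -> exact_cochain c -> exact_cochain (b - c).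
Proof. by move=> eb /exactN; exact: exactD. Qed.

Lemma exact_cpull n (P Q : spair) (f : spmap P Q) (c : cochain RR R n Q) :
  exact_cochain c -> exact_cochain (cpull f c : cochain RR R n P).
Proof.
case: n c => [|n] c; first by move=> ->; rewrite /exact_cochain linear0.
move=> [b rb <-]; exists (cpull f b); first exact: cpull_relative.
exact: diff_cpull.
Qed.

Lemma exact_diff n (P : spair) (b : cochain RR R n P) :
  relative b -> exact_cochain (diff b).
Proof. by exists b. Qed.

Lemma vertex0_subproof k : (delta_mx 0 0 : 'rV[RR]_k.+1) \in Delta k.
Proof.
rewrite inE; split=> [i|]; first by rewrite mxE ler0n.
rewrite (bigD1 ord0)//= big1 ?mxE ?eqxx ?addr0// => i i0.
by rewrite mxE (negbTE i0) andbF.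
Qed.

Definition vertex0 k : Delta k := 
  exist _ (delta_mx 0 0) (vertex0_subproof k).

Lemma relativeP n (P : spair) (c : cochain RR R n P) :
  relative c <->
  forall s : simplex RR n P, (forall x, part P (s x)) -> c s = 0.
Proof.
split=> [c0 s Ps|c0]; last first.
  by apply/funext => s; apply: c0 => x; exact: set_valP.
pose t x : part P := exist _ (s x) (mem_set (Ps x)).
have ct : continuous t.
  by apply: continuous_comp_initial; exact: (@ccont _ _ s).
have -> : s = ccomp (mkcts ct) (incl (part P)) by exact/continuousEP.
by have := congr1 (fun f => f (mkcts ct : simplex _ n _)) c0.
Qed.

Lemma relative_abs n (X : topologicalType) (c : cochain RR R n X) :
  relative (c : cochain RR R n (abs X)).
Proof. by apply/relativeP => s /(_ (vertex0 n)). Qed.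

Lemma cocycle_abs n (X : topologicalType) (c : cochain RR R n X) :
  diff c = 0 -> c \in @cocycle RR R n (abs X).
Proof. by move=> dc; apply/cocycleP; split=> //; exact: relative_abs. Qed.

Lemma prism_relative n (P : spair) (c : cochain RR R n.+1 (P * I)%type) :
  cpull (cyl_map (incl (part P))) c = 0 ->
  relative (prism c : cochain RR R n P).
Proof. by move=> c0; rewrite /relative -prism_cpull c0 linear0. Qed.

(** The defect in the prism formula is the differential of [prism c], which is relative. Phrasing
    this with [exact_cochain] treats degree 0 together with the others. *)
Lemma prism_exact n (P : spair) (c : cochain RR R n (P * I)%type) :
  cpull (cyl_map (incl (part P))) c = 0 ->
  exact_cochain (cpull (cyl_incl P I1) c - cpull (cyl_incl P I0) c -
    prism (diff c) : cochain RR R n P).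
Proof.
case: n c => [|n] c c0; first by rewrite prism_diff0 subrr; exact: exact0.
rewrite -prism_diff addrC addrA addNr add0r.
by apply: exact_diff; exact: prism_relative.
Qed.

Lemma cyl_relative_abs n (X : topologicalType)
    (c : cochain RR R n (X * I)%type) :
  cpull (cyl_map (incl (part (abs X)))) c = 0.
Proof. by apply/funext => s; case: (set_valP (s (vertex0 n)).1). Qed.

Lemma homotopic_pull n (X Y : topologicalType)
    (H : continuousType (X * I)%type Y) (x : coh RR R n (abs Y)) :
  pull (ccomp (cyl_incl X I1) H) x = pull (ccomp (cyl_incl X I0) H) x.
Proof.
have [z ->] := clsP x; rewrite /pull !coh_map_cls; apply/cls_eqP => /=.
have /cocycleP[_ dz] := valP z.
have := @prism_exact n (abs X) (cpull H (val z)) (cyl_relative_abs _).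
by rewrite diff_cpull dz !linear0 addr0 !cpull_comp.
Qed.

Definition id_simplex k : simplex RR k (Delta k) := idfun.

Lemma ccomp_id k (X : topologicalType) (s : simplex RR k X) :
  ccomp (id_simplex k) s = s.
Proof. exact/continuousEP. Qed.

Lemma id_ccomp k (X : topologicalType) (s : continuousType X (Delta k)) :
  ccomp s (id_simplex k) = s.
Proof. exact/continuousEP. Qed.

Section natural_homotopy.
Context (P : spair).
Variable H : forall k, simplex RR k P -> continuousType (Delta k * I)%type P.
Hypothesis H_face : forall k (s : simplex RR k.+1 P) i,
  ccomp (cyl_map (face i)) (H s) = H (ccomp (face i) s).
Hypothesis H_part : forall k (s : simplex RR k P),
  (forall x, part P (s x)) -> forall q, part P (H s q).

(** The homotopies are chosen simplex by simplex and need not come from a homotopy of the space;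
    compatibility with faces suffices for a chain homotopy. *)
Lemma natural_homotopy_exact n (c : cochain RR R n P) :
  relative c -> diff c = 0 ->
  exact_cochain ((fun s => c (ccomp (cyl_incl _ I1) (H s)) -
    c (ccomp (cyl_incl _ I0) (H s))) : cochain RR R n P).
Proof.
have E k (b : cochain RR R k P) (s : simplex RR k P) (t : I) :
    cpull (cyl_incl _ t) (cpull (H s) b) (id_simplex k) =
    b (ccomp (cyl_incl _ t) (H s)).
  by rewrite cpull_comp /cpull ccomp_id.
case: n c => [|n] c rc dc.
  apply/funext => s; rewrite -!E.
  have := congr1 (fun f => f (id_simplex 0)) (prism_diff0 (cpull (H s) c)).
  by rewrite diff_cpull dc !linear0 => /esym E0; exact: E0.
(* The prism operator is evaluated at the universal simplex, inside the domain of each [H s];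
   [H_face] identifies the differential of these values with the one on that domain. *)
exists (fun s => prism (cpull (H s) c) (id_simplex n)).
  apply/relativeP => s Ps; rewrite /prism big1// => i _.
  rewrite [X in _ * X]((relativeP c).1 rc) ?mulr0// => x /=.
  exact: H_part.
apply/funext => s; rewrite -!E.
have := congr1 (fun f => f (id_simplex n.+1)) (prism_diff (cpull (H s) c)).
rewrite diff_cpull dc !linear0 add0r => E0; rewrite -[RHS]E0.
apply: eq_bigr => i _; congr (_ * _).
by rewrite -H_face -cpull_comp prism_cpull /cpull ccomp_id id_ccomp.
Qed.

End natural_homotopy.

(** In the prism formula for one simplex, the correction term consists of values of [c] on prisms
    over the faces, and these lie in the part where [c] vanishes. *)
Lemma homotopic_simplex n (P : spair) (c : cochain RR R n.+1 P)
    (F : continuousType (Delta n.+1 * I)%type P) :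
  relative c -> diff c = 0 ->
  (forall i x t, part P (F (face i x, t))) ->
  c (ccomp (cyl_incl _ I1) F) = c (ccomp (cyl_incl _ I0) F).
Proof.
move=> rc dc FP.
have := congr1 (fun f => f (id_simplex n.+1)) (prism_diff (cpull F c)).
rewrite diff_cpull dc !linear0 add0r.
have -> : diff (prism (cpull F c)) (id_simplex n.+1) = 0.
  rewrite /diff big1// => i _; rewrite /prism big1 ?mulr0// => j _.
  rewrite [X in _ * X]((relativeP c).1 rc) ?mulr0// => x /=.
  exact: FP.
by rewrite /= !fctE /cpull !ccompA !ccomp_id => /esym/eqP; rewrite subr_eq0 => /eqP.
Qed.

End exact_cochains.

(** * Perturbing a map of a simplex away from the origin *)

Section perturbation.
Context {RR : realType}.
Notation Delta n := (@std_simplex RR n).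

Lemma closed_preimage (T U : topologicalType) (f : T -> U) (D : set U) :
  continuous f -> closed D -> closed (f @^-1` D).
Proof. by move=> cf; apply: preimage_closed => x _; exact: cf. Qed.

(** The pairs in [K] whose values differ by at least [e] form a compact set off the diagonal; the
    least distance on it serves as [d]. *)
Lemma unif_continuous_compact (V : normedModType RR) (K : set V)
    (f : V -> RR) (e : RR) :
  compact K -> continuous f -> 0 < e ->
  exists2 d, 0 < d & forall x y, K x -> K y -> `|x - y| < d ->
    `|f x - f y| < e.
Proof.
move=> cK cf e0.
pose A := (K `*` K) `&` [set p : V * V | e <= `|f p.1 - f p.2|].
have cd : continuous (fun p : V * V => `|f p.1 - f p.2| : RR).
  move=> p; apply: cvg_norm; apply: cvgB.
    by apply: continuous_comp (cf _); exact: cvg_fst.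
  by apply: continuous_comp (cf _); exact: cvg_snd.
have cA : compact A.
  apply: compact_closedI; first exact: compact_setX.
  have -> : [set p : V * V | e <= `|f p.1 - f p.2|] =
      (fun p : V * V => `|f p.1 - f p.2| : RR) @^-1` [set t : RR | e <= t] by [].
  exact: closed_preimage cd (@closed_ge _ _).
have [A0|/set0P/negP/negPn/eqP A0] := pselect (A !=set0); last first.
  exists 1 => // x y Kx Ky _; rewrite ltNge; apply/negP => xy.
  by have : A (x, y) by []; rewrite A0.
have cn : {within A, continuous (fun p : V * V => `|p.1 - p.2| : RR)}.
  apply: continuous_subspaceT => p; apply: cvg_norm.
  by apply: cvgB; [exact: cvg_fst|exact: cvg_snd].
have [c /set_mem[_ /= ec] cmin] := compact_EVT_min A0 cA cn.
exists `|c.1 - c.2|.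
  rewrite normr_gt0 subr_eq0; apply/eqP => cE.
  by move: ec; rewrite cE subrr normr0 leNgt e0.
move=> x y Kx Ky xy; rewrite ltNge; apply/negP => fxy.
have /mem_set /cmin /= : A (x, y) by [].
by rewrite leNgt xy.
Qed.

(* The approximation is the inf-convolution of f with a large multiple of the
   norm. *)
Lemma lipschitz_approx (V : normedModType RR) (K : set V)
    (f : V -> RR) (e : RR) :
  compact K -> K !=set0 -> continuous f -> 0 < e ->
  exists L (g : V -> RR), [/\ 0 < L,
    forall x y, `|g x - g y| <= L * `|x - y| &
    forall x, K x -> `|g x - f x| <= e].
Proof.
move=> cK K0 cf e0.
have cfn : {within K, continuous (fun x => `|f x|)}.
  by apply: continuous_subspaceT => x; apply: cvg_norm; exact: cf.
have [c _ cmax] := compact_EVT_max K0 cK cfn.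
have [d d0 fd] := unif_continuous_compact cK cf e0.
pose M := `|f c| + 1.
have M0 : 0 < M by rewrite ltr_pwDr.
have fM x : K x -> `|f x| <= M.
  by move=> /mem_set /cmax fx; rewrite (le_trans fx)// lerDl.
(* With this slope a point at distance at least [d] costs at least [M + M], the largest possible
   variation of [f] on [K], so only points closer than [d] can bring the infimum below [f x]. *)
pose L := (M + M) / d.
have L0 : 0 < L by rewrite divr_gt0// addr_gt0.
pose S x := [set f y + L * `|x - y| | y in K].
have Sb x : has_lbound (S x).
  exists (- M) => _ [y Ky <-].
  have /ler_normlP[fy _] := fM _ Ky.
  by rewrite (@le_trans _ _ (f y))// 1?lerNl// lerDl mulr_ge0// ltW.
have S0 x : S x !=set0 by case: K0 => y Ky; exists (f y + L * `|x - y|), y.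
have gle x y : K y -> inf (S x) <= f y + L * `|x - y|.
  by move=> Ky; apply: ge_inf => //; exists y.
exists L, (fun x => inf (S x)); split => // x.
  have H a b : inf (S a) - inf (S b) <= L * `|a - b|.
    rewrite lerBlDr -lerBlDl; apply: lb_le_inf => // _ [y Ky <-].
    rewrite lerBlDr (le_trans (gle a y Ky))// -addrA lerD2l -mulrDr.
    by rewrite ler_pM2l// [leRHS]addrC ler_distD.
  move=> y; rewrite ler_norml H andbT lerNl opprB.
  by rewrite distrC H.
move=> Kx; rewrite ler_norml; apply/andP; split; last first.
  rewrite lerBlDr (le_trans (gle x x Kx))// subrr normr0 mulr0 addr0.
  by rewrite lerDr ltW.
rewrite lerBrDr; apply: lb_le_inf => // _ [y Ky <-].
have [xy|xy] := ltP `|x - y| d.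
  have /ltr_normlW := fd _ _ Kx Ky xy.
  have : 0 <= L * `|x - y| by rewrite mulr_ge0// ltW.
  lra.
have LM : M + M <= L * `|x - y|.
  by rewrite /L mulrAC ler_pdivlMr// ler_pM2l// addr_gt0.
have /ler_normlP[fy _] := fM _ Ky; have /ler_normlP[_ fx] := fM _ Kx.
lra.
Qed.

Lemma std_simplex_compact k : compact (Delta k).
Proof.
apply: bounded_closed_compact.
  exists 1; split; first exact: num_real.
  move=> M M1 x [x0 x1]; rewrite /Num.norm /= mx_normrE.
  apply/bigmax_leP; split; first exact: ltW (lt_trans ltr01 M1).
  move=> [a j] _ /=; rewrite (ord1 a) ger0_norm// (le_trans _ (ltW M1))//.
  by rewrite -x1 (bigD1 j)//= lerDl sumr_ge0.
have -> : Delta k =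
    \bigcap_(i in [set: 'I_k.+1]) [set x : 'rV[RR]_k.+1 | 0 <= x ord0 i] `&`
    (fun x : 'rV[RR]_k.+1 => \sum_i x ord0 i) @^-1` [set 1].
  apply/seteqP; split=> x [x0 x1]; split=> // i; last exact: (x0 i I).
  by move=> _; exact: x0.
apply: closedI.
  apply: closed_bigI => i _.
  have -> : [set x : 'rV[RR]_k.+1 | 0 <= x ord0 i] =
      (fun x : 'rV[RR]_k.+1 => x ord0 i) @^-1` [set t : RR | 0 <= t] by [].
  exact: closed_preimage (@coord_cont _ _ _) (@closed_ge _ _).
apply: closed_preimage (@closed_eq _ _).
by apply: continuous_sum => j; exact: coord_cont.
Qed.

Lemma le_mx_norm n (x : 'rV[RR]_n) j : `|x ord0 j| <= `|x|.
Proof.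
rewrite [leRHS]/Num.norm /= mx_normrE.
by apply/bigmax_geP; right; exists (ord0, j).
Qed.

Lemma mx_norm_le n (x : 'rV[RR]_n) e :
  0 <= e -> (forall j, `|x ord0 j| <= e) -> `|x| <= e.
Proof.
move=> e0 xe; rewrite /Num.norm /= mx_normrE.
by apply/bigmax_leP; split=> // -[a j] _ /=; rewrite (ord1 a).
Qed.

(** Coordinates sum to 1, so the coordinate 0 is controlled by the other k. Counting cells with k
    coordinates instead of k + 1 is what makes the pigeonhole argument work when k = n. *)
Lemma simplex_norm_le k (x y : 'rV[RR]_k.+1) e : Delta k x -> Delta k y ->
  0 <= e -> (forall j, `|x ord0 (lift ord0 j) - y ord0 (lift ord0 j)| <= e) ->
  `|x - y| <= e *+ k.+1.
Proof.
move=> [_ x1] [_ y1] e0 xy.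
apply: mx_norm_le => [|j]; first exact: mulrn_wge0.
rewrite !mxE; case: (unliftP ord0 j) => [i ->|->].
  by rewrite (le_trans (xy i))// mulrS lerDl mulrn_wge0.
move: x1 y1; rewrite !big_ord_recl => x1 y1.
have -> : x ord0 ord0 - y ord0 ord0 =
    - \sum_i (x ord0 (lift ord0 i) - y ord0 (lift ord0 i)).
  by rewrite sumrB; lra.
rewrite normrN (le_trans (ler_norm_sum _ _ _))//.
rewrite (@le_trans _ _ (\sum_(i < k) e)) ?ler_sum//.
by rewrite sumr_const card_ord mulrS lerDr.
Qed.

(** A counting substitute for the fact that a Lipschitz image of a k-simplex has measure zero: if
    all targets of a fine grid were attained, distinct targets would need distinct cells, of which
    there are too few. *)
Lemma lipschitz_omits (k n : nat) (g : 'rV[RR]_k.+1 -> 'rV[RR]_n.+1) L e :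
  (k <= n)%N -> 0 < L -> 0 < e -> (forall x y, `|g x - g y| <= L * `|x - y|) ->
  exists2 v, `|v| <= e & forall x, Delta k x -> g x != v.
Proof.
move=> kn L0 e0 gL; apply: contrapT => H.
have {}H (v : 'rV[RR]_n.+1) : `|v| <= e -> exists2 x, Delta k x & g x = v.
  move=> ve; apply: contrapT => Hv; apply: H; exists v => // x Dx.
  by apply/eqP => gx; apply: Hv; exists x.
(* A grid of M ^ n.+1 targets against N.+1 ^ k cells of the simplex. *)
pose C := (Num.truncn (L * k.+1%:R / e)).+1.
have CE : L * k.+1%:R < e * C%:R.
  have Le0 : 0 <= L * k.+1%:R / e by rewrite divr_ge0 ?mulr_ge0// ltW.
  by have /andP[_] := truncn_itv Le0; rewrite ltr_pdivrMr// [_ * e]mulrC.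
have C0 : (0 < C)%N by [].
clearbody C.
(* [C] is large enough that points in one cell of side 1/N have images closer than the grid spacing
   e/M. [M] exceeds [C.+1 ^ k], so that [N.+1 ^ k] is at most [(C.+1 * M) ^ k], which is less than
   [M ^ k.+1]. *)
have [M ME] : exists M, M = ((C.+1 ^ k).+1)%N by eexists.
have [N NE] : exists N, N = (C * M)%N by eexists.
have M0 : 0 < M%:R :> RR by rewrite ltr0n ME.
have N0 : 0 < N%:R :> RR by rewrite ltr0n NE muln_gt0 C0 ME.
pose v (m : {ffun 'I_n.+1 -> 'I_M}) : 'rV[RR]_n.+1 :=
  \row_i (e * (m i)%:R / M%:R).
have ve m : `|v m| <= e.
  apply: mx_norm_le => [|j]; first exact: ltW.
  rewrite mxE ger0_norm ?divr_ge0 ?mulr_ge0 ?ler0n ?(ltW e0)//.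
  by rewrite ler_pdivrMr// ler_pM2l// ler_nat ltnW.
have /choice[x xP] m : exists x, Delta k x /\ g x = v m.
  by have [x Dx gx] := H _ (ve m); exists x.
pose cell (m : {ffun 'I_n.+1 -> 'I_M}) : {ffun 'I_k -> 'I_N.+1} :=
  [ffun i => inord (Num.truncn (N%:R * x m ord0 (lift ord0 i)))].
have x01 m j : 0 <= x m ord0 j <= 1.
  have [[x0 x1] _] := xP m; rewrite x0 -x1 (bigD1 j)//= lerDl.
  exact: sumr_ge0.
have cellP m i : (cell m i)%:R <= N%:R * x m ord0 (lift ord0 i) <
    (cell m i).+1%:R.
  have /andP[x0 x1] := x01 m (lift ord0 i).
  have /andP[t0 t1] :=
    truncn_itv (mulr_ge0 (ltW N0) x0).
  rewrite ffunE inordK; first by rewrite t0.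
  rewrite ltnS -(ler_nat RR) (le_trans t0)//.
  by rewrite -[leRHS]mulr1 ler_pM2l.
have cell_inj : injective cell.
  move=> m m' mm'; apply/ffunP => i.
  have [[Dx gx] [Dx' gx']] := (xP m, xP m').
  have xx : `|x m - x m'| <= N%:R^-1 *+ k.+1.
    apply: simplex_norm_le => // [|j]; first by rewrite invr_ge0 ltW.
    have /andP[a1 a2] := cellP m j; have /andP[b1 b2] := cellP m' j.
    move: a1 a2; rewrite mm' => a1 a2.
    rewrite -(ler_pM2l N0) mulfV ?gt_eqF// -{1}(gtr0_norm N0) -normrM mulrBr.
    rewrite -natr1 in a2 b2; rewrite ler_norml; lra.
  have : `|v m ord0 i - v m' ord0 i| < e / M%:R.
    rewrite -gx -gx' (@le_lt_trans _ _ `|g (x m) - g (x m')|)//.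
      by have := le_mx_norm (g (x m) - g (x m')) i; rewrite !mxE.
    rewrite (le_lt_trans (gL _ _))//.
    rewrite (@le_lt_trans _ _ (L * (N%:R^-1 *+ k.+1))) ?ler_pM2l//.
    have C0' : 0 < C%:R :> RR by rewrite ltr0n.
    have -> : L * (N%:R^-1 *+ k.+1) = L * k.+1%:R / C%:R / M%:R.
      rewrite -mulr_natr NE natrM; field.
      by rewrite !gt_eqF.
    by rewrite ltr_pM2r ?invr_gt0// ltr_pdivrMr.
  rewrite !mxE -mulrBl -mulrBr normrM [`|M%:R^-1|]gtr0_norm ?invr_gt0//.
  rewrite ltr_pM2r ?invr_gt0// normrM gtr0_norm// -[ltRHS]mulr1 ltr_pM2l//.
  rewrite ltr_norml => /andP[m1 m2].
  apply: val_inj; apply/eqP; rewrite eqn_leq.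
  by apply/andP; split; rewrite -ltnS -(ltr_nat RR) -natr1; lra.
have := leq_card cell cell_inj.
rewrite !card_ffun !card_ord leqNgt => /negP; apply.
apply: (@leq_ltn_trans ((C.+1 * M) ^ k)).
  case: k {gL H v ve x xP cell x01 cellP cell_inj g CE} kn ME => // k _ ME.
  by rewrite leq_exp2r// mulSn NE -addn1 addnC leq_add2r ME.
apply: (@leq_trans (M ^ k.+1)); last by rewrite leq_pexp2l ?ME.
by rewrite expnS expnMn ltn_pmul2r ?expn_gt0 ME.
Qed.

(** A continuous [f] may fill space, so it is first replaced by a Lipschitz map at the cost of e/2;
    subtracting an omitted vector of norm at most e/2 then removes the zeros. *)
Lemma nonvanishing_approx (k n : nat) (f : 'rV[RR]_k.+1 -> 'rV[RR]_n.+1)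
    (e : RR) :
  (k <= n)%N -> continuous f -> 0 < e ->
  exists2 g : 'rV[RR]_k.+1 -> 'rV[RR]_n.+1, continuous g &
    forall x, Delta k x -> g x != 0 /\ `|g x - f x| <= e.
Proof.
move=> kn cf e0; have e2 : 0 < e / 2 by rewrite divr_gt0.
have D0 : Delta k !=set0.
  by exists (set_val (vertex0 k)); exact: set_valP.
have cfi i : continuous (fun x => f x ord0 i).
  by move=> x; apply: continuous_comp (@coord_cont _ _ _ _); exact: cf.
have /choice[L /choice[g gP]] i :=
  lipschitz_approx (@std_simplex_compact k) D0 (cfi i) e2.
pose h x : 'rV[RR]_n.+1 := \row_i g i x.
pose LL := \sum_i L i.
have L0 i : 0 < L i by case: (gP i).
have LL0 : 0 < LL.
  by rewrite /LL big_ord_recl ltr_pwDl// sumr_ge0// => i _; exact: ltW.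
have hL x y : `|h x - h y| <= LL * `|x - y|.
  apply: mx_norm_le => [|i]; first by rewrite mulr_ge0// ltW.
  rewrite !mxE; have [_ gl _] := gP i; rewrite (le_trans (gl _ _))//.
  rewrite ler_wpM2r// /LL (bigD1 i)//= lerDl sumr_ge0// => j _; exact: ltW.
have ch : continuous h.
  move=> x; apply/(@cvgrPdist_le _ _ _ _ (@nbhs_filter _ x)) => d d0.
  have cx : (fun y : 'rV[RR]_k.+1 => y) @ x --> x by exact: cvg_id.
  have := @pseudometric_normed_Zmodule.cvgr_dist_le _ _ _ _ (nbhs_filter x) _ _
    cx _ (divr_gt0 d0 LL0).
  apply: filterS => y xy.
  by rewrite (le_trans (hL _ _))// mulrC -ler_pdivlMr.
have [v ve hv] := lipschitz_omits kn LL0 e2 hL.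
exists (fun x => h x - v) => [x|x Dx]; last first.
  split; first by rewrite subr_eq0; exact: hv.
  rewrite (splitr e) -addrA [- v - _]addrC addrA (le_trans (ler_normB _ _))//.
  rewrite lerD//; apply: mx_norm_le => [|i]; first exact: ltW.
  by rewrite !mxE; case: (gP i) => _ _; apply.
exact: (@cvgB _ _ _ _ (nbhs_filter x) h (cst v) _ _ (ch x) (cvg_cst _)).
Qed.

End perturbation.

(** * Trivializing a bundle over a simplex *)

Lemma within_comp (X Y Z : topologicalType) (A : set X) (B : set Y)
    (f : X -> Y) (g : Y -> Z) :
  A `<=` f @^-1` B -> {within A, continuous f} -> {within B, continuous g} ->
  {within A, continuous (g \o f)}.
Proof.
move=> AB /subspace_continuousP cf /subspace_continuousP cg.
apply/subspace_continuousP => x Ax U gU.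
have := cg (f x) (AB _ Ax) U gU.
rewrite /= !nbhs_simpl /within /= => H.
have := cf x Ax _ H; rewrite /= !nbhs_simpl /within /=.
by apply: filterS => y + Ay => /(_ Ay); apply; exact: AB.
Qed.

Lemma within_pair (X Y Z : topologicalType) (A : set X)
    (f : X -> Y) (g : X -> Z) :
  {within A, continuous f} -> {within A, continuous g} ->
  {within A, continuous (fun x => (f x, g x))}.
Proof.
move=> /subspace_continuousP cf /subspace_continuousP cg.
by apply/subspace_continuousP => x Ax; apply: cvg_pair; [exact: cf|exact: cg].
Qed.

(** Only the pieces [A] and [B] are closed. The set [D] will be a fibre product over [X], which need
    not be closed as [X] need not be Hausdorff. *)
Lemma within_paste (X Y : topologicalType) (D A B : set X) (f : X -> Y) :
  closed A -> closed B -> A `|` B = setT ->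
  {within D `&` A, continuous f} -> {within D `&` B, continuous f} ->
  {within D, continuous f}.
Proof.
move=> cA cB AB ctsA ctsB; apply/continuous_closedP => W oW.
case/continuous_closedP/(_ _ oW)/closed_subspaceP: ctsA => V1 cV1 V1W.
case/continuous_closedP/(_ _ oW)/closed_subspaceP: ctsB => V2 cV2 V2W.
apply/closed_subspaceP; exists ((V1 `&` A) `|` (V2 `&` B)).
  by apply: closedU; exact: closedI.
apply/seteqP; split=> t.
  move=> [[] [Vt At] Dt]; split=> //.
    by have [] : (f @^-1` W `&` (D `&` A)) t by rewrite -V1W.
  by have [] : (f @^-1` W `&` (D `&` B)) t by rewrite -V2W.
move=> [Wt Dt]; split=> //.
have : (A `|` B) t by rewrite AB.
case=> Ct; [left|right]; split=> //.
  by have [] : (V1 `&` (D `&` A)) t by rewrite V1W.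
by have [] : (V2 `&` (D `&` B)) t by rewrite V2W.
Qed.

Lemma within_eq (X Y : topologicalType) (A : set X) (f g : X -> Y) :
  (forall x, A x -> f x = g x) -> {within A, continuous f} ->
  {within A, continuous g}.
Proof.
by move=> fg; apply: subspace_eq_continuous => x /set_mem; exact: fg.
Qed.

(** Subdivision of the unit interval without a mesh: local validity at the supremum of the s with
    [P 0 s] would carry [P] past that supremum unless 1 is reached. *)
Lemma segment_gluing (RR : realType) (P : RR -> RR -> Prop) :
  (forall a b c, a <= b -> b <= c -> P a b -> P b c -> P a c) ->
  (forall s, exists2 e, 0 < e & forall a b, s - e <= a -> a <= b ->
    b <= s + e -> P a b) ->
  P 0 1.
Proof.
move=> glue loc.
pose S := [set s | 0 <= s <= 1 /\ P 0 s].
have S0 : S 0.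
  split; first by rewrite lexx ler01.
  by have [e e0] := loc 0; apply; rewrite ?add0r ?oppr_le0// ltW.
have supS : has_sup S.
  by split; [exists 0|exists 1 => s [/andP[]]].
have [e e0 eP] := loc (sup S).
have [s [/andP[s0 s1] Ps] es] := sup_adherent e0 supS.
have sS : s <= sup S by apply: ub_le_sup => //; [case: supS|split; rewrite ?s0].
pose t := Num.min (sup S + e) 1.
have st : s <= t by rewrite le_min s1 (le_trans sS)// lerDl ltW.
have Pt : P 0 t.
  apply: (glue _ s) => //; apply: eP => //; first exact: ltW.
  by rewrite ge_min lexx.
have tS : t <= sup S.
  apply: ub_le_sup; first by case: supS.
  by split; rewrite // (le_trans s0 st) ge_min lexx orbT.
move: Pt tS; rewrite /t minEle; case: ifP => // _ _.
by rewrite gerDl leNgt e0.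
Qed.

Section trivial_over.
Context {RR : realType} {X : topologicalType} {r m : nat}.
Context (E : vbundle RR X r) (q : 'rV[RR]_m -> X).
Hypothesis cq : continuous q.
Implicit Type S : set 'rV[RR]_m.

(* A fibrewise homeomorphism of the pullback of E over S with S x RR^r
   preserving zero; linearity is not recorded. *)
Definition trivial_over S := exists (h : 'rV[RR]_m * tot E -> 'rV[RR]_r)
    (k : 'rV[RR]_m * 'rV[RR]_r -> tot E),
  [/\ {within [set p | S p.1 /\ proj E p.2 = q p.1], continuous h},
      {within [set p | S p.1], continuous k},
      forall x v, S x -> proj E (k (x, v)) = q x /\ h (x, k (x, v)) = v,
      forall x e, S x -> proj E e = q x -> k (x, h (x, e)) = e &
      forall x, S x -> k (x, 0) = zsec E (q x)].

Lemma trivial_overS S S' : S `<=` S' -> trivial_over S' -> trivial_over S.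
Proof.
move=> SS' [h [k [hc kc kp kh k0]]]; exists h, k; split.
- by apply: continuous_subspaceW hc => p [/SS'].
- by apply: continuous_subspaceW kc => p /SS'.
- by move=> x v /SS'; exact: kp.
- by move=> x v /SS'; exact: kh.
- by move=> x /SS'; exact: k0.
Qed.

Lemma trivial_over_local (x : 'rV[RR]_m) : exists2 e, 0 < e &
  trivial_over [set y : 'rV[RR]_m | forall i, `|y ord0 i - x ord0 i| <= e].
Proof.
have [U [h [k [oU Ux T]]]] := locally_trivial E (q x).
have /cq : nbhs (q x) U by exact: open_nbhs_nbhs.
rewrite /= nbhs_simpl /= -nbhs_ballE => -[e /= e0 eU].
exists (e / 2); first exact: divr_gt0.
apply: (@trivial_overS _ (q @^-1` U)).
  move=> y yx; apply: eU; rewrite -ball_normE /= distrC.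
  rewrite (@le_lt_trans _ _ (e / 2)) ?gtr_pMr ?invf_lt1 ?ltr1n//.
  apply: mx_norm_le => [|j]; first by rewrite ltW// divr_gt0.
  by rewrite !mxE; exact: yx.
exists (fun p => h p.2), (fun p => k (q p.1) p.2); split.
- apply: (within_comp _ _ (triv_continuous T)) => /=.
    by move=> p [Up /= ->].
  by apply: continuous_subspaceT => p; exact: cvg_snd.
- apply: (@within_comp _ _ _ _ _ (fun p => (q p.1, p.2)) _ _ _
    (triv_inv_continuous T)) => //.
  apply: continuous_subspaceT.
  apply: pair_continuous (@snd_continuous _ _).
  exact: comp_continuous (@fst_continuous _ _) cq.
- by move=> y v Uy /=; rewrite (triv_proj T)// (trivKV T).
- by move=> y e' Uy /= pe; rewrite -pe (trivK T)// pe.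
- move=> y Uy /=; rewrite -(triv_zsec T Uy).
  by rewrite -{1}(proj_zsec E (q y)) (trivK T)// proj_zsec.
Qed.

Definition set_coord (j : 'I_m) (c : RR) (x : 'rV[RR]_m) : 'rV[RR]_m :=
  \row_i (if i == j then c else x ord0 i).

Lemma set_coord_continuous j c : continuous (set_coord j c).
Proof.
apply: rV_continuous => i; rewrite /set_coord.
under eq_fun do rewrite mxE.
by case: (i == j); [exact: cst_continuous|exact: coord_cont].
Qed.

Lemma set_coord_id j (x : 'rV[RR]_m) : set_coord j (x ord0 j) x = x.
Proof. by apply/rowP => i; rewrite mxE; case: eqP => // ->. Qed.

(** Two trivializations differ over the wall where the coordinate j equals c by a fibrewise change
    of coordinates. Extending this change along the projection [rho] onto the wall corrects the
    second one so that both agree there. *)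
Lemma trivial_over_glue S j c :
  (forall x : 'rV[RR]_m, S x -> c <= x ord0 j -> S (set_coord j c x)) ->
  trivial_over [set x : 'rV[RR]_m | S x /\ x ord0 j <= c] ->
  trivial_over [set x : 'rV[RR]_m | S x /\ c <= x ord0 j] ->
  trivial_over S.
Proof.
move=> Sc [h1 [k1 [hc1 kc1 kp1 kh1 k01]]] [h2 [k2 [hc2 kc2 kp2 kh2 k02]]].
pose rho := set_coord j c.
have rhoj x : rho x ord0 j = c by rewrite /rho /set_coord mxE eqxx.
have Sr x : S x -> c <= x ord0 j ->
    [/\ S (rho x), rho x ord0 j <= c & c <= rho x ord0 j].
  by move=> Sx cx; rewrite rhoj; split=> //; exact: Sc.
have rho_id (x : 'rV[RR]_m) : x ord0 j <= c -> c <= x ord0 j -> rho x = x.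
  by move=> xc cx; rewrite /rho (_ : c = x ord0 j) ?set_coord_id//;
    apply/le_anti; rewrite xc cx.
(* The vector is read in the second chart, carried with the same coordinates to the wall, and read
   there in the first chart; [k'] goes back the same way. *)
pose h' p := h1 (rho p.1, k2 (rho p.1, h2 p)).
pose k' p := k2 (p.1, h2 (rho p.1, k1 (rho p.1, p.2))).
pose h (p : 'rV[RR]_m * tot E) := if p.1 ord0 j <= c then h1 p else h' p.
pose k (p : 'rV[RR]_m * 'rV[RR]_r) := if p.1 ord0 j <= c then k1 p else k' p.
have hE (x : 'rV[RR]_m) e : S x -> proj E e = q x -> c <= x ord0 j -> h (x, e) = h' (x, e).
  move=> Sx pe cx; rewrite /h /=; case: ifPn => // xc.
  by rewrite /h' /= rho_id// kh2.
have kE (x : 'rV[RR]_m) v : S x -> c <= x ord0 j -> k (x, v) = k' (x, v).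
  move=> Sx cx; rewrite /k /=; case: ifPn => // xc.
  by rewrite /k' /= rho_id// kh2//; case: (kp1 x v).
have c1 (Y : topologicalType) : continuous (fun p : 'rV[RR]_m * Y => p.1 ord0 j).
  exact: comp_continuous (@fst_continuous _ _) (@coord_cont _ _ _).
have cle (Y : topologicalType) : closed [set p : 'rV[RR]_m * Y | p.1 ord0 j <= c].
  exact: (@closed_preimage _ _ (fun p : 'rV[RR]_m * Y => p.1 ord0 j)
    [set t : RR | t <= c] (c1 Y) (@closed_le _ c)).
have cge (Y : topologicalType) : closed [set p : 'rV[RR]_m * Y | c <= p.1 ord0 j].
  exact: (@closed_preimage _ _ (fun p : 'rV[RR]_m * Y => p.1 ord0 j)
    [set t : RR | c <= t] (c1 Y) (@closed_ge _ c)).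
have cU (Y : topologicalType) : [set p : 'rV[RR]_m * Y | p.1 ord0 j <= c] `|`
    [set p : 'rV[RR]_m * Y | c <= p.1 ord0 j] = setT.
  by apply/seteqP; split=> // p _; apply/orP; exact: le_total.
have crho (Y : topologicalType) (A : set ('rV[RR]_m * Y)) :
    {within A, continuous (fun p => rho p.1)}.
  apply: continuous_subspaceT.
  exact: comp_continuous (@fst_continuous _ _) (@set_coord_continuous j c).
exists h, k; split.
- apply: (within_paste (cle _) (cge _) (cU _)).
    apply: (@within_eq _ _ _ h1) => [[x e] [_ /= xc]|]; first by rewrite /h /= xc.
    by apply: continuous_subspaceW hc1 => p [[Sp pp] pc].
  apply: (@within_eq _ _ _ h') => [[x e] [[Sx pe] cx]|]; first by rewrite hE.
  apply: (within_comp _ _ hc1) => [[x e] /= [[Sx pe] cx]|].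
    have [Srx r1 r2] := Sr x Sx cx.
    by split=> //; case: (kp2 (rho x) (h2 (x, e))).
  apply: within_pair; first exact: crho.
  apply: (within_comp _ _ kc2) => [[x e] /= [[Sx pe] cx]|].
    by have [] := Sr x Sx cx.
  apply: within_pair; first exact: crho.
  by apply: continuous_subspaceW hc2 => p [[]].
- apply: (within_paste (cle _) (cge _) (cU _)).
    apply: (@within_eq _ _ _ k1) => [[x e] [_ /= xc]|]; first by rewrite /k /= xc.
    by apply: continuous_subspaceW kc1 => p [].
  apply: (@within_eq _ _ _ k') => [[x e] [Sx cx]|]; first by rewrite kE.
  apply: (within_comp _ _ kc2) => [[x e] /= [Sx cx]|] //.
  apply: within_pair; first by apply: continuous_subspaceT; exact: fst_continuous.
  apply: (within_comp _ _ hc2) => [[x e] /= [Sx cx]|].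
    have [Srx r1 r2] := Sr x Sx cx.
    by split=> //; case: (kp1 (rho x) e).
  apply: within_pair; first exact: crho.
  apply: (within_comp _ _ kc1) => [[x e] /= [Sx cx]|].
    by have [] := Sr x Sx cx.
  apply: within_pair; first exact: crho.
  by apply: continuous_subspaceT; exact: snd_continuous.
- move=> x v Sx; have [xc|/ltW cx] := leP (x ord0 j) c.
    by rewrite /h /k /= xc; exact: kp1.
  have [Srx r1 r2] := Sr x Sx cx.
  have [p1 q1] := kp1 (rho x) v (conj Srx r1).
  have [p2 q2] := kp2 x (h2 (rho x, k1 (rho x, v))) (conj Sx cx).
  rewrite kE// hE// /k' /h' /= q2 kh2//; by rewrite q1.
- move=> x e Sx pe; have [xc|/ltW cx] := leP (x ord0 j) c.
    by rewrite /h /k /= xc; exact: kh1.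
  have [Srx r1 r2] := Sr x Sx cx.
  have [p2 q2] := kp2 (rho x) (h2 (x, e)) (conj Srx r2).
  by rewrite hE// kE// /k' /h' /= kh1// q2 kh2.
- move=> x Sx; have [xc|/ltW cx] := leP (x ord0 j) c.
    by rewrite /k /= xc; exact: k01.
  have [Srx r1 r2] := Sr x Sx cx.
  rewrite kE// /k' /= k01// -k02//.
  by have [_ ->] := kp2 (rho x) 0 (conj Srx r2); exact: k02.
Qed.

Lemma trivial_over_cube :
  trivial_over [set x : 'rV[RR]_m | forall i, 0 <= x ord0 i <= 1].
Proof.
(* Coordinates are freed one at a time: the first j range over the unit interval and the others stay
   near [x]. *)
pose Box (j : nat) (x : 'rV[RR]_m) (e : RR) := [set y : 'rV[RR]_m | forall i : 'I_m,
  if (i < j)%N then 0 <= y ord0 i <= 1 else `|y ord0 i - x ord0 i| <= e].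
suff H j : (j <= m)%N -> forall x, exists2 e, 0 < e & trivial_over (Box j x e).
  have [e _] := H m (leqnn m) 0.
  by apply: trivial_overS => y y01 i; rewrite ltn_ord.
elim: j => [_ x|j IH jm x]; first exact: trivial_over_local.
pose jj := Ordinal jm.
(* The radius is quantified inside [P] because each gluing keeps the smaller of two radii. *)
pose P a b := exists2 e, 0 < e & trivial_over [set y : 'rV[RR]_m |
  a <= y ord0 jj <= b /\ forall i : 'I_m, i != jj ->
  if (i < j)%N then 0 <= y ord0 i <= 1 else `|y ord0 i - x ord0 i| <= e].
suff [e e0 Pe] : P 0 1.
  exists e => //; apply: trivial_overS Pe => y By; split.
    by have := By jj; rewrite /= ltnSn.
  move=> i ij; have := By i; rewrite ltnS leq_eqVlt.
  by move: ij; rewrite -val_eqE /= => /negbTE ->.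
apply: segment_gluing => [a b c ab bc [e1 e10 P1] [e2 e20 P2]|s].
  exists (Num.min e1 e2); first by rewrite lt_min e10.
  apply: (@trivial_over_glue _ jj b) => [y [/andP[ay yc] yx] by_||].
  - split=> [|i ij]; first by rewrite mxE eqxx ab.
    by have := yx i ij; rewrite mxE (negbTE ij).
  - apply: trivial_overS P1 => y [[/andP[ay yc] yx] yb]; split=> [|i ij].
      by rewrite ay.
    by have := yx i ij; case: ifP => // _; rewrite le_min => /andP[].
  - apply: trivial_overS P2 => y [[/andP[ay yc] yx] yb]; split=> [|i ij].
      by rewrite yb.
    by have := yx i ij; case: ifP => // _; rewrite le_min => /andP[].
have [e e0 Te] := IH (ltnW jm) (set_coord jj s x).
exists e => // a b sa ab bs; exists e => //.
apply: trivial_overS Te => y [/andP[ay yb] yx] i; rewrite mxE.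
have [->|ij] := eqVneq i jj; last exact: yx.
by rewrite ltnn ler_norml; apply/andP; split; lra.
Qed.

End trivial_over.

(** * Extending sections from the boundary of a simplex *)

Section retractions.
Context {RR : realType}.
Notation I := (@unit_itv RR).
Notation Delta n := (@std_simplex RR n).

(** The maximum of t and 0, in a form whose continuity follows from that of the norm. *)
Definition pos_part (t : RR) : RR := (`|t| + t) / 2.

Lemma pos_part_ge0 t : 0 <= pos_part t.
Proof. by rewrite divr_ge0// -lerBlDr sub0r -normrN ler_norm. Qed.

Lemma pos_part_id t : 0 <= t -> pos_part t = t.
Proof. by move=> t0; rewrite /pos_part ger0_norm//; field. Qed.

Lemma pos_part_le0 t : t <= 0 -> pos_part t = 0.
Proof. by move=> t0; rewrite /pos_part ler0_norm// addNr mul0r. Qed.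

Lemma pos_partB t : pos_part t - pos_part (- t) = t.
Proof. by rewrite /pos_part normrN; field. Qed.

Lemma pos_part_continuous (T : topologicalType) (f : T -> RR) :
  continuous f -> continuous (fun x => pos_part (f x)).
Proof.
move=> cf x; apply: cvgM; last exact: cvg_cst.
by apply: cvgD; [apply: cvg_norm|]; exact: cf.
Qed.

Definition pos_sum k (x : 'rV[RR]_k.+1) : RR :=
  \sum_j pos_part (x ord0 j).

(** After negative coordinates are cut off, a sum below 1 is made up in the coordinate 0 and a sum
    above 1 is divided out. The denominator is at least 1, so the formula is continuous
    everywhere. *)
Definition retract_row k (x : 'rV[RR]_k.+1) : 'rV[RR]_k.+1 :=
  \row_j ((pos_part (x ord0 j) +
      (if j == ord0 then pos_part (1 - pos_sum x) else 0))
    / (1 + pos_part (pos_sum x - 1))).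

Lemma retract_row_simplex k (x : 'rV[RR]_k.+1) : Delta k (retract_row x).
Proof.
have s0 : 0 < 1 + pos_part (pos_sum x - 1).
  by rewrite ltr_pwDl// pos_part_ge0.
split=> [i|].
  rewrite mxE divr_ge0// ?(ltW s0)// addr_ge0 ?pos_part_ge0//.
  by case: ifP => // _; rewrite pos_part_ge0.
under eq_bigr do rewrite mxE.
rewrite -mulr_suml big_split /= -/(pos_sum x) -big_mkcond /= big_pred1_eq.
apply: (mulIf (lt0r_neq0 s0)); rewrite mulfVK ?gt_eqF// mul1r.
by have := pos_partB (1 - pos_sum x); rewrite opprB => H; lra.
Qed.

Lemma retract_row_id k (x : 'rV[RR]_k.+1) : Delta k x -> retract_row x = x.
Proof.
move=> [x0 x1]; apply/rowP => j; rewrite mxE.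
have -> : pos_sum x = 1.
  by rewrite -x1; apply: eq_bigr => i _; rewrite pos_part_id.
by rewrite subrr !pos_part_id// if_same !addr0 divr1.
Qed.

Lemma retract_row_continuous k : continuous (@retract_row k).
Proof.
have cm (j : 'I_k.+1) :
    continuous (fun x : 'rV[RR]_k.+1 => pos_part (x ord0 j)).
  by apply: pos_part_continuous; exact: coord_cont.
have cs : continuous (@pos_sum k) by exact: continuous_sum.
apply: rV_continuous => j; rewrite /retract_row /=.
under eq_fun do rewrite mxE.
have c0 : continuous (fun x : 'rV[RR]_k.+1 =>
    if j == ord0 then pos_part (1 - pos_sum x) else 0).
  case: (j == ord0); last exact: cst_continuous.
  apply: pos_part_continuous => y.
  exact: cvgB (cvg_cst _) (cs y).
have c1 : continuous (fun x : 'rV[RR]_k.+1 => pos_part (pos_sum x - 1)).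
  apply: pos_part_continuous => y.
  exact: cvgB (cs y) (cvg_cst _).
have cn : continuous (fun x : 'rV[RR]_k.+1 => pos_part (x ord0 j) +
    (if j == ord0 then pos_part (1 - pos_sum x) else 0)).
  by move=> x; exact: cvgD (cm j x) (c0 x).
have cd : continuous (fun x : 'rV[RR]_k.+1 =>
    (1 + pos_part (pos_sum x - 1))^-1).
  move=> x; have n0 : 1 + pos_part (pos_sum x - 1) != 0.
    by rewrite gt_eqF// ltr_pwDl// pos_part_ge0.
  exact: cvgV n0 (cvgD (cvg_cst _) (c1 x)).
by move=> x; exact: cvgM (cn x) (cd x).
Qed.

Definition simplex_retract_fun k (x : 'rV[RR]_k.+1) : Delta k :=
  exist _ (retract_row x) (mem_set (retract_row_simplex x)).

Lemma simplex_retract_continuous k : continuous (@simplex_retract_fun k).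
Proof. by apply: continuous_comp_initial; exact: retract_row_continuous. Qed.

Definition simplex_retract k : continuousType 'rV[RR]_k.+1 (Delta k) :=
  mkcts (@simplex_retract_continuous k).

Lemma simplex_retractK k (x : Delta k) : simplex_retract k (set_val x) = x.
Proof. by apply: val_inj; apply: retract_row_id; exact: set_valP. Qed.

Lemma compact_simplexT k : compact [set: Delta k].
Proof.
have -> : [set: Delta k] = simplex_retract k @` Delta k.
  apply/seteqP; split=> // x _; exists (set_val x); first exact: set_valP.
  exact: simplex_retractK.
apply: continuous_compact (@std_simplex_compact _ k).
by apply: continuous_subspaceT; exact: (@ccont _ _ (simplex_retract k)).
Qed.

Lemma itv_retract_subproof (t : RR) :
  pos_part t - pos_part (t - 1) \in I.
Proof.
rewrite inE /unit_itv /= in_itv /=.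
have [t0|/ltW t0] := leP t 0.
  by rewrite !pos_part_le0 ?subrr ?lexx ?ler01//; lra.
rewrite pos_part_id//; have [t1|/ltW t1] := leP t 1.
  by rewrite pos_part_le0; lra.
by rewrite pos_part_id; lra.
Qed.

Definition itv_retract_fun (t : RR) : I :=
  exist _ (pos_part t - pos_part (t - 1)) (itv_retract_subproof t).

Lemma itv_retract_continuous : continuous itv_retract_fun.
Proof.
have c1 : continuous (fun t : RR => pos_part t).
  by apply: pos_part_continuous => t; exact: cvg_id.
have c2 : continuous (fun t : RR => pos_part (t - 1)).
  by apply: pos_part_continuous => t; exact: cvgB cvg_id (cvg_cst _).
by apply: continuous_comp_initial => t; exact: cvgB (c1 t) (c2 t).
Qed.

Lemma itv_retractK (t : I) : itv_retract_fun (set_val t) = t.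
Proof.
have := set_valP t; rewrite /unit_itv /= in_itv /= => /andP[t0 t1].
by apply: val_inj; rewrite /= pos_part_id// pos_part_le0 ?subr0 ?subr_le0.
Qed.

Lemma compact_itvT : compact [set: I].
Proof.
have -> : [set: I] = itv_retract_fun @` `[0, 1].
  apply/seteqP; split=> // t _; exists (set_val t); first exact: set_valP.
  exact: itv_retractK.
apply: continuous_compact (@segment_compact _ 0 1).
by apply: continuous_subspaceT; exact: itv_retract_continuous.
Qed.

(** Tietze extension in each coordinate; compactness of [A] supplies the bound that the bounded
    extension theorem takes as input. *)
Lemma vector_tietze k n (A : set (Delta k * I))
    (f : Delta k * I -> 'rV[RR]_n) :
  closed A -> {within A, continuous f} ->
  exists2 g : Delta k * I -> 'rV[RR]_n, continuous g &
    forall q, A q -> g q = f q.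
Proof.
move=> cA cf.
have cAc : compact A.
  apply: subclosed_compact cA _ (@subsetT _ _).
  by rewrite -setXTT; exact: compact_setX (@compact_simplexT k) compact_itvT.
have ext i : exists g : Delta k * I -> RR, continuous g /\
    forall q, A q -> g q = f q ord0 i.
  have cfi : {within A, continuous ((fun v : 'rV[RR]_n => v ord0 i) \o f)}.
    apply: (within_comp (B := setT) _ cf) => //.
    by apply: continuous_subspaceT; exact: coord_cont.
  have [A0|A0] := pselect (A !=set0); last first.
    exists (fun=> 0); split=> [|q Aq]; first exact: cst_continuous.
    by case: A0; exists q.
  have cn : {within A, continuous
      ((fun t : RR => `|t|) \o (fun q => f q ord0 i))}.
    apply: (within_comp (B := setT) _ cfi) => //.
    by apply: continuous_subspaceT; exact: norm_continuous.
  have [c _ cmax] := compact_EVT_max A0 cAc cn.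
  have M0 : 0 < `|f c ord0 i| + 1 by rewrite ltr_pwDr.
  have [q Aq|g [fg cg _]] := continuous_bounded_extension
    (@pseudometric_normal RR (Delta k * I)%type) cA M0 cfi.
    by rewrite (le_trans (cmax q (mem_set Aq)))// lerDl.
  by exists g; split=> // q Aq; rewrite -fg// inE.
have /choice[g gP] := ext.
exists (fun q => \row_i g i q) => [|q Aq].
  apply: rV_continuous => i; under eq_fun do rewrite mxE.
  by case: (gP i).
by apply/rowP => i; rewrite mxE; case: (gP i) => _; apply.
Qed.

End retractions.

Section simplex_trivialization.
Context {RR : realType} {X : topologicalType} {r k : nat}.
Context (E : vbundle RR X r).
Notation Delta n := (@std_simplex RR n).

Lemma nonzeroP (e : tot E) : nonzero E e <-> zsec E (proj E e) <> e.
Proof.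
split=> [e0 ze|ze [x _ xe]]; first by apply: e0; exists (proj E e).
by apply: ze; rewrite -xe proj_zsec.
Qed.

(** The simplex lies in the unit cube and [tau] extends to all rows through the retraction. The
    coordinate map [h] is meaningful only on the fibre product, hence its continuity is expressed by
    test maps into it. *)
Lemma simplex_trivialization (tau : continuousType (Delta k) X) :
  exists (h : Delta k -> tot E -> 'rV[RR]_r)
         (K : continuousType (Delta k * 'rV[RR]_r)%type (tot E)),
  [/\ forall (Z : topologicalType) (A : set Z) (s : Z -> Delta k) (e : Z -> tot E),
        {within A, continuous s} -> {within A, continuous e} ->
        (forall z, A z -> proj E (e z) = tau (s z)) ->
        {within A, continuous (fun z => h (s z) (e z))},
      forall x v, proj E (K (x, v)) = tau x,
      forall x e, proj E e = tau x -> K (x, h x e) = e,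
      forall x v, v != 0 -> nonzero E (K (x, v)) &
      forall x e, proj E e = tau x -> nonzero E e -> h x e != 0].
Proof.
pose q : 'rV[RR]_k.+1 -> X := ccomp (simplex_retract k) tau.
have qE (x : Delta k) : q (set_val x) = tau x.
  by rewrite /q /= simplex_retractK.
have : trivial_over E q (Delta k).
  apply: trivial_overS (trivial_over_cube _ (@ccont _ _ _)).
  move=> x [x0 x1] i; rewrite x0 /= -x1 (bigD1 i)//= lerDl.
  exact: sumr_ge0.
move=> [h [K [hc Kc Kp Kh K0]]].
have cv (Z : topologicalType) (A : set Z) (s : Z -> Delta k) :
    {within A, continuous s} -> {within A, continuous (fun z => set_val (s z))}.
  move=> cs; apply: (within_comp (B := setT) _ cs) => //.
  by apply: continuous_subspaceT; exact: set_val_continuous.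
have cK : continuous (fun p : Delta k * 'rV[RR]_r => K (set_val p.1, p.2)).
  apply/continuous_subspace_setT.
  apply: (within_comp (B := [set p | Delta k p.1]) _ _ Kc).
    by move=> p _; exact: set_valP.
  apply: within_pair.
    by apply: cv; apply: continuous_subspaceT; exact: fst_continuous.
  by apply: continuous_subspaceT; exact: snd_continuous.
exists (fun x e => h (set_val x, e)), (mkcts cK); split.
- move=> Z A s e cs ce pe; apply: (within_comp _ _ hc).
    by move=> z Az; split; [exact: set_valP|rewrite /= pe// qE].
  by apply: within_pair => //; exact: cv.
- by move=> x v; rewrite /= (Kp _ v (set_valP x)).1 qE.
- by move=> x e pe /=; apply: Kh; [exact: set_valP|rewrite qE].
- move=> x v v0; apply/nonzeroP => /=.
  rewrite (Kp _ v (set_valP x)).1 -K0; last exact: set_valP.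
  move=> /(congr1 (fun e => h (set_val x, e))).
  rewrite (Kp _ v (set_valP x)).2 (Kp _ 0 (set_valP x)).2 => E0.
  by rewrite -E0 eqxx in v0.
move=> x e pe /nonzeroP e0; apply/eqP => h0; apply: e0.
by rewrite pe -qE -K0 -?h0; [apply: Kh; rewrite ?qE//|]; exact: set_valP.
Qed.

End simplex_trivialization.

Section extension.
Context {RR : realType} {X : topologicalType} {n : nat}.
Context (E : vbundle RR X n.+1).
Notation I := (@unit_itv RR).
Notation Delta n := (@std_simplex RR n).

Definition simplex_bd k : set (Delta k) :=
  [set x : Delta k | exists i, set_val x ord0 i = 0].

Lemma set_val_coord_continuous k (i : 'I_k.+1) :
  continuous (fun x : Delta k => set_val x ord0 i : RR).
Proof.
exact: comp_continuous (@set_val_continuous _ _) (@coord_cont _ _ _).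
Qed.

Lemma closed_simplex_bd k : closed (@simplex_bd k).
Proof.
have -> : @simplex_bd k =
    \bigcup_(i in [set: 'I_k.+1]) [set x : Delta k | set_val x ord0 i = 0].
  by apply/seteqP; split=> x [i xi]; exists i.
apply: closed_bigcup => [|i _]; first exact: finite_finset.
exact: closed_preimage (@set_val_coord_continuous k i) (@closed_eq _ 0).
Qed.

Lemma within_bd k (Z : topologicalType) (f : Delta k * I -> Z) :
  (forall i, {within [set q : Delta k * I | set_val q.1 ord0 i = 0], continuous f}) ->
  {within [set q : Delta k * I | simplex_bd q.1], continuous f}.
Proof.
move=> fc.
have -> : [set q : Delta k * I | simplex_bd q.1] =
    \big[setU/set0]_(i <- enum 'I_k.+1) [set q : Delta k * I | set_val q.1 ord0 i = 0].
  apply/seteqP; split=> q; rewrite -bigcup_seq.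
    by move=> [i qi]; exists i => //=; rewrite mem_enum.
  by move=> [i _ qi]; exists i.
have cl i : closed [set q : Delta k * I | set_val q.1 ord0 i = 0].
  apply: (@closed_preimage _ _ (fun q : Delta k * I => set_val q.1 ord0 i)
    [set t | t = 0] _ (@closed_eq _ 0)).
  exact: comp_continuous (@fst_continuous _ _) (@set_val_coord_continuous k i).
elim: (enum _) => [|i s IH].
  by rewrite big_nil; exact: continuous_subspace0.
rewrite big_cons; apply: withinU_continuous => //.
by apply: closed_bigsetU => j _; exact: cl.
Qed.

(** On the compact boundary the norm of [F (x, I1)] has a positive lower bound [m]. A nonvanishing
    approximation is blended in only where the norm is below [m], and in proportion to t, so that
    the boundary and the start are fixed. *)
Lemma push_off_zero k (F : Delta k * I -> 'rV[RR]_n.+1) :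
  (k <= n)%N -> continuous F ->
  (forall x, simplex_bd x -> F (x, I1) != 0) ->
  exists2 F' : Delta k * I -> 'rV[RR]_n.+1, continuous F' &
    [/\ forall x, F' (x, I0) = F (x, I0),
        forall x t, simplex_bd x -> F' (x, t) = F (x, t) &
        forall x, F' (x, I1) != 0].
Proof.
move=> kn cF bdF.
have cF1 : continuous (fun x => F (x, I1)).
  apply: (@comp_continuous _ _ _ (fun x => (x, I1)) F _ cF).
  apply: pair_continuous; last exact: cst_continuous.
  by move=> x; exact: cvg_id.
have cn : continuous (fun x => `|F (x, I1)|).
  exact: comp_continuous cF1 (@norm_continuous _ _).
have [m m0 mP] : exists2 m : RR, 0 < m &
    forall x, simplex_bd x -> m <= `|F (x, I1)|.
  have [B0|B0] := pselect (@simplex_bd k !=set0); last first.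
    by exists 1 => // x Bx; case: B0; exists x.
  have cB : compact (@simplex_bd k).
    exact: subclosed_compact (@closed_simplex_bd k) (@compact_simplexT _ _)
      (@subsetT _ _).
  have [c /set_mem Bc cmin] := compact_EVT_min B0 cB (continuous_subspaceT cn).
  exists `|F (c, I1)|; first by rewrite normr_gt0 bdF.
  by move=> x Bx; apply: cmin; rewrite inE.
(* Where the blending is partial the norm exceeds m/2, so a correction of size at most m/4 cannot
   create a zero; where the norm is at most m/2 the end map is [g] itself. *)
have m4 : 0 < m / 4 by rewrite divr_gt0.
have [g cg gP] := nonvanishing_approx kn
  (comp_continuous (@ccont _ _ (simplex_retract k)) cF1) m4.
(* A cutoff, 1 where |F (x, I1)| <= m / 2 and 0 where |F (x, I1)| >= m. *)
pose lam x : RR := pos_part (2 - 2 * `|F (x, I1)| / m) -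
  pos_part (1 - 2 * `|F (x, I1)| / m).
have cl (c : RR) : continuous (fun x => pos_part (c - 2 * `|F (x, I1)| / m)).
  apply: pos_part_continuous; apply: (@funB_continuous RR _ RR^o).
    exact: cst_continuous.
  apply: funM_continuous; last exact: cst_continuous.
  by apply: funM_continuous => //; exact: cst_continuous.
have clam : continuous lam by exact: (@funB_continuous RR _ RR^o).
have mE (t : RR) : 2 * t / m = 2 * (t / m) by rewrite mulrA.
have lam0 x : m <= `|F (x, I1)| -> lam x = 0.
  move=> mF; have : 1 <= `|F (x, I1)| / m by rewrite ler_pdivlMr// mul1r.
  by move=> H; rewrite /lam mE !pos_part_le0 ?subrr//; lra.
have lam1 x : `|F (x, I1)| <= m / 2 -> lam x = 1.
  move=> mF; have : `|F (x, I1)| / m <= 2^-1.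
    by rewrite ler_pdivrMr// mulrC.
  by move=> H; rewrite /lam mE !pos_part_id; lra.
have lam01 x : `|lam x| <= 1.
  have [mF|/ltW mF] := leP `|F (x, I1)| (m / 2).
    by rewrite lam1// normr1.
  have H : 2^-1 <= `|F (x, I1)| / m by rewrite ler_pdivlMr// mulrC.
  rewrite /lam mE [X in _ - X]pos_part_le0 ?subr0; last by lra.
  rewrite ger0_norm ?pos_part_ge0//.
  have [le|/ltW le] := leP 0 (2 - 2 * (`|F (x, I1)| / m)).
    by rewrite pos_part_id//; lra.
  by rewrite pos_part_le0.
pose d x := g (set_val x) - F (x, I1).
have cd : continuous d.
  apply: funB_continuous cF1.
  exact: (comp_continuous (@set_val_continuous _ _) cg).
have gx x : g (set_val x) != 0 /\ `|d x| <= m / 4.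
  by have := gP _ (set_valP x); rewrite /= simplex_retractK.
exists (fun q => F q + (set_val q.2 * lam q.1) *: d q.1); last split.
- apply: funD_continuous => //; apply: funZ_continuous.
    apply: funM_continuous.
      exact: comp_continuous (@snd_continuous _ _) (@set_val_continuous _ _).
    exact: comp_continuous (@fst_continuous _ _) clam.
  exact: comp_continuous (@fst_continuous _ _) cd.
- by move=> x; rewrite /= mul0r scale0r addr0.
- by move=> x t /mP /lam0 /= ->; rewrite mulr0 scale0r addr0.
move=> x /=; rewrite mul1r; have [g0 dx] := gx x.
have [mF|mF] := leP `|F (x, I1)| (m / 2).
  by rewrite lam1// scale1r /d addrC subrK.
rewrite -normr_gt0 (lt_le_trans _ (lerB_normD _ _))// subr_gt0.
rewrite (le_lt_trans _ mF)// normrZ.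
apply: (@le_trans _ _ (1 * (m / 4))); first exact: ler_pM.
by rewrite mul1r; lra.
Qed.

(** Read in a trivialization over the simplex, the data on the bottom and the sides form a
    vector-valued map on a closed set. It extends by Tietze, and for k at most n its end is then
    pushed off zero. *)
Lemma boundary_extension k (s : simplex RR k (tot E)) (b : Delta k * I -> tot E) :
  (forall i, {within [set q : Delta k * I | set_val q.1 ord0 i = 0], continuous b}) ->
  (forall x t, simplex_bd x -> proj E (b (x, t)) = proj E (s x)) ->
  (forall x, simplex_bd x -> b (x, I0) = s x) ->
  ((k <= n)%N -> forall x, simplex_bd x -> nonzero E (b (x, I1))) ->
  exists H : continuousType (Delta k * I)%type (tot E),
  [/\ forall x t, proj E (H (x, t)) = proj E (s x),
      forall x, H (x, I0) = s x,
      forall x t, simplex_bd x -> H (x, t) = b (x, t) &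
      (k <= n)%N -> forall x, nonzero E (H (x, I1))].
Proof.
move=> bc bv b0 b1.
have [h [K [hc Kv Kh K1 h1]]] := simplex_trivialization E (ccomp s (proj E)).
pose A := [set q : Delta k * I | q.2 = I0] `|` [set q : Delta k * I | simplex_bd q.1].
pose f (q : Delta k * I) := if q.2 == I0 then h q.1 (s q.1) else h q.1 (b q).
have cfst (Y : topologicalType) (B : set (Delta k * I)) (g : Delta k -> Y) :
    continuous g -> {within B, continuous (g \o fst)}.
  move=> cg; apply: continuous_subspaceT.
  exact: comp_continuous (@fst_continuous _ _) cg.
have cI0 : closed [set q : Delta k * I | q.2 = I0].
  have -> : [set q : Delta k * I | q.2 = I0] =
      (fun q : Delta k * I => set_val q.2) @^-1` [set t : RR | t = 0].
    apply/seteqP; split=> q /=; first by move=> ->.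
    by move=> q0; apply: val_inj.
  apply: closed_preimage (@closed_eq _ _).
  exact: comp_continuous (@snd_continuous _ _) (@set_val_continuous _ _).
have cbd : closed [set q : Delta k * I | simplex_bd q.1].
  exact: closed_preimage (@fst_continuous _ _) (@closed_simplex_bd k).
have cA : closed A by exact: closedU.
have cf : {within A, continuous f}.
  apply: withinU_continuous => //.
    apply: (@within_eq _ _ _ (fun q => h q.1 (s q.1))).
      by move=> q /= q0; rewrite /f q0 eqxx.
    apply: hc => //; first by apply: (cfst _ _ idfun) => x; exact: cvg_id.
    by apply: (cfst _ _ s); exact: (@ccont _ _ s).
  apply: (@within_eq _ _ _ (fun q => h q.1 (b q))).
    move=> [x t] /= Bx; rewrite /f /=; case: eqP => // ->.
    by rewrite b0.
  apply: hc => [||[x t] Bx]; last exact: bv.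
    by apply: (cfst _ _ idfun) => x; exact: cvg_id.
  exact: within_bd.
have [F cF FA] := vector_tietze cA cf.
have F0 x : F (x, I0) = h x (s x).
  by rewrite FA; [rewrite /f eqxx|left].
have Fb x t : simplex_bd x -> F (x, t) = h x (b (x, t)).
  move=> Bx; rewrite FA; last by right.
  by rewrite /f /=; case: eqP => // ->; rewrite b0.
have [F' cF' [F'0 F'b F'1]] : exists2 F' : Delta k * I -> 'rV[RR]_n.+1, continuous F' &
    [/\ forall x, F' (x, I0) = F (x, I0),
        forall x t, simplex_bd x -> F' (x, t) = F (x, t) &
        (k <= n)%N -> forall x, F' (x, I1) != 0].
  have [kn|kn] := boolP (k <= n)%N; last by exists F.
  have bd1 x : simplex_bd x -> F (x, I1) != 0.
    by move=> Bx; rewrite Fb//; apply: h1; [exact: bv|exact: b1].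
  by have [F' cF' [? ? ?]] := push_off_zero kn cF bd1; exists F'.
have cH : continuous (fun q => K (q.1, F' q)).
  apply: (@comp_continuous _ _ _ (fun q => (q.1, F' q)) K _ (@ccont _ _ K)).
  exact: pair_continuous (@fst_continuous _ _) cF'.
exists (mkcts cH); split=> [x t|x|x t Bx|kn x] /=.
- exact: Kv.
- by rewrite -[LHS]/(K (x, F' (x, I0))) F'0 F0 Kh.
- by rewrite -[LHS]/(K (x, F' (x, t))) F'b// Fb// Kh// bv.
- exact/K1/F'1.
Qed.

End extension.

(** * Faces of the standard simplex and their intersections *)

Section faces.
Context {RR : realType}.
Notation Delta n := (@std_simplex RR n).

Lemma face_coord k (i : 'I_k.+2) (x : Delta k) : set_val (face i x) ord0 i = 0.
Proof. by rewrite /= mxE unlift_none. Qed.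

Lemma face_bd k (i : 'I_k.+2) (x : Delta k) : simplex_bd (face i x).
Proof. by exists i; exact: face_coord. Qed.

Lemma face_lift k (i : 'I_k.+2) (x : Delta k) l :
  set_val (face i x) ord0 (lift i l) = set_val x ord0 l.
Proof. by rewrite /= mxE liftK. Qed.

Lemma face_inj k (i : 'I_k.+2) : injective (@face RR k i).
Proof.
move=> x y xy; apply: val_inj; apply/rowP => l.
by rewrite -[LHS](face_lift i) xy [LHS]face_lift.
Qed.

(** The inverse of [face i] on its wall; the retraction makes it a continuous map on the whole
    simplex. *)
Definition drop_coord k (i : 'I_k.+2) (y : Delta k.+1) : Delta k :=
  simplex_retract k (\row_l set_val y ord0 (lift i l)).

Lemma drop_coord_continuous k (i : 'I_k.+2) : continuous (drop_coord i).
Proof.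
apply: (@comp_continuous _ _ _ (fun y : Delta k.+1 =>
  \row_l set_val y ord0 (lift i l)) _ _ (@ccont _ _ (simplex_retract k))).
apply: rV_continuous => l; under eq_fun do rewrite mxE.
exact: set_val_coord_continuous.
Qed.

Lemma drop_coordK k (i : 'I_k.+2) (y : Delta k.+1) :
  set_val y ord0 i = 0 -> face i (drop_coord i y) = y.
Proof.
move=> yi; have [y0 y1] := set_valP y.
have D : Delta k (\row_l set_val y ord0 (lift i l)).
  split=> [l|]; first by rewrite mxE.
  rewrite -y1 (bigD1_ord i)//= yi add0r.
  by apply: eq_bigr => l _; rewrite mxE.
have dE : set_val (drop_coord i y) = \row_l set_val y ord0 (lift i l).
  exact: retract_row_id.
apply: val_inj; apply/rowP => j; case: (unliftP i j) => [l ->|->].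
  by rewrite [LHS]face_lift dE mxE.
by rewrite [LHS]face_coord yi.
Qed.

Lemma face_meet k (i j : 'I_k.+3) (x y : Delta k.+1) : (j < i)%N ->
  face i x = face j y ->
  exists w : Delta k, x = face (inord j) w /\ y = face (inord i.-1) w.
Proof.
move=> ji xy; have := ltn_ord i; have := ltn_ord j => jk ik.
have xj : set_val x ord0 (inord j) = 0.
  rewrite -(face_lift i).
  have -> : lift i (inord j) = j.
    by apply: val_inj; rewrite /= inordK /bump; lia.
  by rewrite xy face_coord.
exists (drop_coord (inord j) x); rewrite drop_coordK//; split=> //.
apply: (@face_inj _ j); rewrite -xy -{1}(drop_coordK xj).
have /continuousEP : ccomp (face (inord j)) (face i) =
    ccomp (face (inord i.-1)) (@face RR _ j).
  by apply: face_face; rewrite ?inordK//; lia.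
exact.
Qed.

Lemma face_neq0 (i j : 'I_2) (x y : Delta 0) : face i x = face j y -> i = j.
Proof.
move=> xy; apply/eqP; apply: contraT => ij.
have [l jl _] := unlift_some ij.
have := face_coord j y; rewrite -xy jl face_lift (ord1 l).
have [_] := set_valP x; rewrite big_ord1 => -> /eqP.
by rewrite oner_eq0.
Qed.

Lemma simplex_bd0 (x : Delta 0) : ~ simplex_bd x.
Proof.
move=> [i]; rewrite (ord1 i).
have [_] := set_valP x; rewrite big_ord1 => -> /eqP.
by rewrite oner_eq0.
Qed.

End faces.

(** * Natural compression of simplices towards the nonzero vectors *)

Section compression.
Context {RR : realType} {X : topologicalType} {n : nat}.
Context (E : vbundle RR X n.+1).
Notation I := (@unit_itv RR).
Notation Delta n := (@std_simplex RR n).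

Definition homotopies k :=
  simplex RR k (tot E) -> continuousType (Delta k * I)%type (tot E).

(** [compress_cst] keeps simplices of [Tot_0] inside it, as relative cochains demand.
    [compress_coherent] concerns the faces of a simplex one dimension higher: it is the inductive
    condition under which their homotopies glue along its boundary. *)
Record compressing k (H : homotopies k) : Prop := Compressing {
  compress_proj : forall s q, proj E (H s q) = proj E (s q.1);
  compress_start : forall s x, H s (x, I0) = s x;
  compress_cst : forall s : simplex RR k (tot E), (forall x, nonzero E (s x)) ->
    forall q, H s q = s q.1;
  compress_end : (k <= n)%N -> forall s x, nonzero E (H s (x, I1));
  compress_coherent : forall (s : simplex RR k.+1 (tot E)) i j x y t,
    face i x = face j y ->
    H (ccomp (face i) s) (x, t) = H (ccomp (face j) s) (y, t)
}.

Definition cst_homotopy k (s : simplex RR k (tot E)) :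
    continuousType (Delta k * I)%type (tot E) :=
  mkcts (comp_continuous (@fst_continuous _ _) (@ccont _ _ s)).

Lemma compressing0 : exists H : homotopies 0, compressing H.
Proof.
have /choice[H HP] (s : simplex RR 0 (tot E)) :
    exists H : continuousType (Delta 0 * I)%type (tot E),
    [/\ forall q, proj E (H q) = proj E (s q.1),
      forall x, H (x, I0) = s x,
      (forall x, nonzero E (s x)) -> forall q, H q = s q.1 &
      forall x, nonzero E (H (x, I1))].
  have [s0|s0] := pselect (forall x, nonzero E (s x)).
    by exists (cst_homotopy s); split=> // x; exact: s0.
  have bc i : {within [set q : Delta 0 * I | set_val q.1 ord0 i = 0],
      continuous (fun q => s q.1)}.
    by apply: continuous_subspaceT; exact: (@ccont _ _ (cst_homotopy s)).
  have [||_|H [Hp H0 _ H1]] := @boundary_extension _ _ _ E _ s _ bc => //.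
    by move=> x /simplex_bd0.
  by exists H; split=> // [[x t]|x]; [exact: Hp|exact: H1].
exists H; split.
- by move=> s q; case: (HP s).
- by move=> s x; case: (HP s).
- by move=> s s0 q; case: (HP s) => _ _ + _; apply.
- by move=> _ s x; case: (HP s).
- move=> s i j x y t xy; have ij := face_neq0 xy.
  by move: xy; rewrite ij => /face_inj ->.
Qed.

Lemma compressingS k (H : homotopies k) : compressing H ->
  exists2 H' : homotopies k.+1, compressing H' &
    forall s i, ccomp (cyl_map (face i)) (H' s) = H (ccomp (face i) s).
Proof.
move=> cH.
have /choice[H' HP] (s : simplex RR k.+1 (tot E)) :
    exists H' : continuousType (Delta k.+1 * I)%type (tot E),
    [/\ forall q, proj E (H' q) = proj E (s q.1),
      forall x, H' (x, I0) = s x,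
      (forall x, nonzero E (s x)) -> forall q, H' q = s q.1,
      (k.+1 <= n)%N -> forall x, nonzero E (H' (x, I1)) &
      forall i x t, H' (face i x, t) = H (ccomp (face i) s) (x, t)].
  (* A simplex already in [Tot_0] must stay fixed; its faces lie in [Tot_0] too, so the constant
     homotopy restricts correctly. *)
  have [s0|s0] := pselect (forall x, nonzero E (s x)).
    exists (cst_homotopy s); split=> // i x t.
    by rewrite (compress_cst cH)// => z; exact: s0.
  (* The chosen face and preimage do not matter, by coherence. Off the boundary the value [s q.1] is
     a dummy. *)
  pose b (q : Delta k.+1 * I) : tot E :=
    if pselect (exists p : 'I_k.+2 * Delta k, face p.1 p.2 = q.1)
    is left ex then
      let p := projT1 (cid ex) in H (ccomp (face p.1) s) (p.2, q.2)
    else s q.1.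
  have bE i x t : b (face i x, t) = H (ccomp (face i) s) (x, t).
    rewrite /b; case: pselect => [ex|[]]; last by exists (i, x).
    by case: (cid ex) => -[j y] /= yx; exact: (compress_coherent cH).
  have bd x : simplex_bd x -> exists i y, x = face i y.
    by move=> [i xi]; exists i, (drop_coord i x); rewrite drop_coordK.
  have bc i : {within [set q : Delta k.+1 * I | set_val q.1 ord0 i = 0],
      continuous b}.
    apply: (@within_eq _ _ _
      (fun q => H (ccomp (face i) s) (drop_coord i q.1, q.2))).
      by move=> [x t] /= xi; rewrite -bE drop_coordK.
    apply: continuous_subspaceT.
    apply: (@comp_continuous _ _ _ (fun q => (drop_coord i q.1, q.2)) _ _
      (@ccont _ _ (H (ccomp (face i) s)))).
    apply: pair_continuous (@snd_continuous _ _).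
    exact: comp_continuous (@fst_continuous _ _) (@drop_coord_continuous _ k i).
  have [|||H' [Hp H0 Hb H1]] := @boundary_extension _ _ _ E _ s _ bc.
  - by move=> x t /bd[i [y ->]]; rewrite bE (compress_proj cH).
  - by move=> x /bd[i [y ->]]; rewrite bE (compress_start cH).
  - move=> kn x /bd[i [y ->]]; rewrite bE.
    by apply: (compress_end cH); exact: ltnW.
  exists H'; split=> //; first by move=> [x t]; exact: Hp.
  by move=> i x t; rewrite -bE Hb//; exact: face_bd.
have HE s i x t : H' s (face i x, t) = H (ccomp (face i) s) (x, t).
  by case: (HP s).
exists H'; last by move=> s i; apply/continuousEP => -[x t]; exact: HE.
split.
- by move=> s q; case: (HP s).
- by move=> s x; case: (HP s).
- by move=> s s0 q; case: (HP s) => _ _ + _ _; apply.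
- by move=> kn s x; case: (HP s) => _ _ _ + _; apply.
(* Coherence one dimension up: a point common to two distinct faces lies on a common face of
   codimension 2, where both homotopies restrict to [H] of the same simplex. *)
move=> s i j x y t; wlog ji : i j x y / (j <= i)%N => [W|].
  have [/W|/ltnW/W] := leqP j i; first exact.
  by move=> {}W xy; apply/esym/W.
have [->|ij] := eqVneq i j; first by move=> /face_inj ->.
have {ij}ji : (j < i)%N by rewrite ltn_neqAle eq_sym ij.
move=> /(face_meet ji)[w [-> ->]]; rewrite !HE -!ccompA.
have := ltn_ord i; have := ltn_ord j => jk ik.
by rewrite (@face_face _ _ i (inord j) (inord i.-1) j)// inordK//; lia.
Qed.

Lemma natural_compression : exists H : forall k, homotopies k,
  (forall k, compressing (H k)) /\
  forall k (s : simplex RR k.+1 (tot E)) i,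
    ccomp (cyl_map (face i)) (H k.+1 s) = H k (ccomp (face i) s).
Proof.
have [H0 cH0] := compressing0.
pose step k (H : {H : homotopies k | compressing H}) :=
  cid2 (compressingS (proj2_sig H)).
pose fam := nat_rect (fun k => {H : homotopies k | compressing H})
  (exist _ H0 cH0) (fun k H => exist _ _ (s2valP (step k H))).
exists (fun k => sval (fam k)); split=> [k|k s i]; first exact: (proj2_sig (fam k)).
exact: (s2valP' (step k (fam k))).
Qed.

End compression.

(** * Detection of degree n + 1 classes on fibres *)

Section thom_uniqueness.
Context {RR : realType} {R : comPzRingType} {X : topologicalType} {n : nat}.
Context (E : vbundle RR X n.+1).
Notation I := (@unit_itv RR).
Notation Delta n := (@std_simplex RR n).

Lemma cls0 k (P : spair) : cls (0 : cocycles RR R k P) = 0.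
Proof. by apply: (addrI (cls 0)); rewrite -clsD !addr0. Qed.

Lemma cls_eq0 k (P : spair) (z : cocycles RR R k P) :
  cls z = 0 <-> exact_cochain (val z).
Proof. by rewrite -cls0 cls_eqP /= subr0. Qed.

(* Contracting the base of the simplex moves f into a single fibre, keeping its
   faces in Tot_0 E. *)
Lemma fiber_detect (c : cochain RR R n.+1 (tot E))
    (f : simplex RR n.+1 (tot E)) :
  relative (c : cochain RR R n.+1 (tot_pair E)) -> diff c = 0 ->
  (forall x, exact_cochain (cpull (rincl (P := tot_pair E) (proj E @^-1` [set x])) c
    : cochain RR R n.+1 (fiber E x))) ->
  (forall i x, nonzero E (f (face i x))) ->
  c f = 0.
Proof.
move=> rc dc fc f0.
have [h [K [hc Kv Kh K1 h1]]] := simplex_trivialization E (ccomp f (proj E)).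
pose v x := h x (f x).
have cv : continuous v.
  apply/continuous_subspace_setT; apply: hc => //; apply: continuous_subspaceT.
    by move=> x; exact: cvg_id.
  exact: (@ccont _ _ f).
have v0 i x : v (face i x) != 0 by apply: h1.
pose w : Delta n.+1 := vertex0 n.+1.
(* The straight segment to the vertex [w], made a point of the simplex by the retraction, which
   saves a convexity argument. *)
pose path (q : Delta n.+1 * I) : Delta n.+1 := simplex_retract n.+1
  (set_val q.1 + set_val q.2 *: (set_val w - set_val q.1)).
have cpath : continuous path.
  apply: (@comp_continuous _ _ _ (fun q : Delta n.+1 * I =>
    set_val q.1 + set_val q.2 *: (set_val w - set_val q.1)) _ _
    (@ccont _ _ (simplex_retract n.+1))).
  have c1 : continuous (fun q : Delta n.+1 * I => set_val q.1).
    exact: comp_continuous (@fst_continuous _ _) (@set_val_continuous _ _).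
  apply: funD_continuous => //; apply: funZ_continuous.
    exact: comp_continuous (@snd_continuous _ _) (@set_val_continuous _ _).
  by apply: funB_continuous => //; exact: cst_continuous.
have cF : continuous (fun q => K (path q, v q.1)).
  apply: (@comp_continuous _ _ _ (fun q => (path q, v q.1)) _ _ (@ccont _ _ K)).
  apply: pair_continuous => //.
  exact: comp_continuous (@fst_continuous _ _) cv.
pose F : continuousType (Delta n.+1 * I)%type (tot_pair E) := mkcts cF.
have F0 : ccomp (cyl_incl _ I0) F = f.
  apply/continuousEP => x; rewrite -[LHS]/(K (path (x, I0), v x)).
  by rewrite /path /= scale0r addr0 simplex_retractK Kh.
have := @homotopic_simplex _ R _ (tot_pair E) c F rc dc.
rewrite F0 => <- => [|i x t]; last exact/K1/v0.
set x0 := proj E (f w).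
have path1 x : path (x, I1) = w.
  rewrite /path -[set_val (_, _).2]/(1 : RR) scale1r addrC subrK.
  exact: simplex_retractK.
have F1 x : (proj E @^-1` [set x0]) (F (x, I1)).
  by rewrite -[F _]/(K (path (x, I1), v x)) /= Kv path1.
pose g x : proj E @^-1` [set x0] := exist _ (F (x, I1)) (mem_set (F1 x)).
have cg : continuous g.
  apply: continuous_comp_initial.
  exact: (@ccont _ _ (ccomp (cyl_incl _ I1) F)).
(* In a single fibre the cocycle has a relative primitive, and its differential is evaluated on
   faces consisting of nonzero vectors. *)
have [b rb db] := fc x0.
have := congr1 (fun d => d (mkcts cg : simplex RR n.+1 (fiber E x0))) db.
rewrite /cpull /=.
have -> : ccomp (mkcts cg) (incl (proj E @^-1` [set x0])) = ccomp (cyl_incl _ I1) F.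
  exact/continuousEP.
move=> <-; rewrite /diff big1// => i _.
rewrite [X in _ * X]((relativeP _).1 rb) ?mulr0// => x.
exact/K1/v0.
Qed.

(** Compression moves all n-dimensional faces into [Tot_0], so the compressed simplices are within
    reach of [fiber_detect]. The cocycle vanishes on them, and the compression homotopy makes it
    exact. *)
Lemma fiberwise_zero (u : coh RR R n.+1 (tot_pair E)) :
  (forall x, coh_map (rincl (P := tot_pair E) (proj E @^-1` [set x])) u = 0) ->
  u = 0.
Proof.
have [z ->] := clsP u => u0; apply/cls_eq0.
have /cocycleP[rz dz] := valP z.
have fz x : exact_cochain (cpull (rincl (P := tot_pair E)
    (proj E @^-1` [set x])) (val z) : cochain RR R n.+1 (fiber E x)).
  by have := u0 x; rewrite coh_map_cls => /cls_eq0.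
have [H [cH Hface]] := natural_compression E.
have := @natural_homotopy_exact RR R (tot_pair E) H Hface _ n.+1 _ rz dz.
have -> : (fun s => val z (ccomp (cyl_incl _ I1) (H n.+1 s)) -
    val z (ccomp (cyl_incl _ I0) (H n.+1 s))) = - val z.
  apply/funext => s; rewrite (fiber_detect rz dz fz) => [|i x].
    rewrite sub0r; congr (- val z _); apply/continuousEP => x.
    exact: (compress_start (cH _)).
  have /continuousEP/(_ (x, I1)) := Hface n s i; rewrite /= => ->.
  exact: (compress_end (cH n)).
move=> Hz; rewrite -[val z]opprK; apply: exactN; apply: Hz.
by move=> k s s0 q; rewrite (compress_cst (cH k) s0); exact: s0.
Qed.

Lemma thom_class_unique (o : orientation (R := R) n.+1 E)
    (u u' : coh RR R n.+1 (tot_pair E)) :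
  is_thom_class o u -> is_thom_class o u' -> u = u'.
Proof.
move=> tu tu'; apply/eqP; rewrite -subr_eq0; apply/eqP/fiberwise_zero => x.
by rewrite linearB /= tu tu' subrr.
Qed.

End thom_uniqueness.

Lemma exact_forget (RR : realType) (R : comPzRingType) n (P : spair)
    (c : cochain RR R n P) :
  exact_cochain c -> exact_cochain (c : cochain RR R n (abs P)).
Proof.
by case: n c => [//|n] c [b _ <-]; apply: exact_diff; exact: relative_abs.
Qed.

(** Extending a primitive by zero and then differentiating gives a cocycle on the whole space that
    is exact there. Subtracting it makes a cochain with exact restriction relative. *)
Lemma exact_extension (RR : realType) (R : comPzRingType) n (P : spair)
    (Y : topologicalType) (f : continuousType (part P) Y)
    (c : cochain RR R n Y) :
  exact_cochain (c : cochain RR R n (abs Y)) ->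
  exists b : cochain RR R n P, [/\ diff b = 0,
    exact_cochain (b : cochain RR R n (abs P)) &
    cpull (incl (part P)) b = cpull f c].
Proof.
case: n c => [|n] c; first by move=> ->; exists 0; rewrite !linear0.
move=> [b _ <-]; exists (diff (extend0 (cpull f b))); split.
- exact: diff_diff.
- by apply: exact_diff; exact: relative_abs.
- by rewrite -!diff_cpull extend0K.
Qed.

(** * Injectivity of the pullback to the nonzero vectors in degree n *)

Section injectivity.
Context {RR : realType} {R : comPzRingType} {G : topologicalGroupType}.
Context {X : topologicalType} {n : nat} (E : vbundle RR X n.+1).
Notation I := (@unit_itv RR).
Notation Delta n := (@std_simplex RR n).

Definition id_map (Y Z : topologicalType) (f : continuousType Y Z) :
    continuousType (G * Y)%type (G * Z)%type := 
  mkcts (@id_times_continuous G _ _ f).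

Definition prod_pair : spair := @SPair (G * tot E)%type [set q | nonzero E q.2].

Definition prod_part_fun (q : part prod_pair) : G * tot0 E :=
  ((set_val q).1, exist _ (set_val q).2 (mem_set (set_valP q))).

Lemma prod_part_continuous : continuous prod_part_fun.
Proof.
apply: pair_continuous.
  exact: comp_continuous (@set_val_continuous _ _) (@fst_continuous _ _).
apply: continuous_comp_initial.
exact: comp_continuous (@set_val_continuous _ _) (@snd_continuous _ _).
Qed.

(** The compression acts on the bundle coordinate with the coordinate in [G] fixed. In degree n it
    ends entirely in the nonzero vectors, where [c] vanishes. *)
Lemma prod_pair_exact (c : cochain RR R n prod_pair) :
  relative c -> diff c = 0 -> exact_cochain c.
Proof.
move=> rc dc; have [H [cH Hface]] := natural_compression E.
have cHG k (s : simplex RR k prod_pair) : continuous (fun q : Delta k * I =>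
    ((s q.1).1, H k (ccomp s (@pr2 G (tot E))) q) : G * tot E).
  apply: pair_continuous; last exact: (@ccont _ _ (H k _)).
  apply: (@comp_continuous _ _ _ (fun q => s q.1) fst).
    exact: comp_continuous (@fst_continuous _ _) (@ccont _ _ s).
  exact: fst_continuous.
pose HG k (s : simplex RR k prod_pair) :
  continuousType (Delta k * I)%type prod_pair := mkcts (cHG k s).
have HGface k (s : simplex RR k.+1 prod_pair) i :
    ccomp (cyl_map (face i)) (HG k.+1 s) = HG k (ccomp (face i) s).
  apply/continuousEP => q; congr pair.
  by have /continuousEP/(_ q) := Hface k (ccomp s (@pr2 G (tot E))) i; rewrite ccompA.
have := @natural_homotopy_exact RR R prod_pair HG HGface _ n _ rc dc.
have -> : (fun s => c (ccomp (cyl_incl _ I1) (HG n s)) -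
    c (ccomp (cyl_incl _ I0) (HG n s))) = - c.
  apply/funext => s; rewrite ((relativeP c).1 rc) => [|x]; last first.
    exact: (compress_end (cH n)).
  rewrite sub0r; congr (- c _); apply/continuousEP => x.
  rewrite -[LHS]/((s x).1, H n (ccomp s (@pr2 G (tot E))) (x, I0)).
  by rewrite (compress_start (cH _)) /=; case: (s x).
move=> Hc; rewrite -[c]opprK; apply: exactN; apply: Hc.
move=> k s s0 q; rewrite /HG /= (compress_cst (cH k)); first exact: s0.
exact: s0.
Qed.

(** By vanishing of the relative group in degree n, restriction from [G * tot E] to the nonzero
    vectors is injective; pulling back to [G * tot E] is injective because the zero section is a
    section of the projection. *)
Lemma pull_id_p0_inj (x : coh RR R n (abs (G * X)%type)) :
  pull (id_p0 (G := G) (E := E)) x = 0 -> x = 0.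
Proof.
have [z ->] := clsP x; rewrite /pull coh_map_cls => /cls_eq0 /= z0.
apply/cls_eq0; have /cocycleP[_ dz] := valP z.
pose psi : continuousType (part prod_pair) (G * tot0 E)%type :=
  mkcts prod_part_continuous.
pose c : cochain RR R n prod_pair := cpull (id_map (proj E)) (val z).
have dc : diff c = 0 by rewrite /c diff_cpull dz linear0.
have czE : cpull (id_map (zsec E)) c = val z.
  rewrite /c cpull_comp; apply/funext => s; congr (val z _).
  apply/continuousEP => y.
  rewrite -[LHS]/((s y).1, proj E (zsec E (s y).2)) proj_zsec.
  by case: (s y).
have cpE : cpull (incl (part prod_pair)) c =
    cpull psi (cpull (id_p0 (G := G) (E := E)) (val z)).
  by rewrite /c !cpull_comp; apply/funext => s; congr (val z _); exact/continuousEP.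
suff ec : exact_cochain (c : cochain RR R n (abs (G * tot E)%type)).
  by rewrite -czE; exact: (exact_cpull
    (abs_map (P := abs (G * tot E)%type) (id_map (zsec E)))).
have [b [db0 eb rb]] := exact_extension (P := prod_pair) psi z0.
have e1 : exact_cochain (c - b).
  apply: prod_pair_exact; first by rewrite /relative linearB /= rb cpE subrr.
  by rewrite linearB /= dc db0 subrr.
rewrite -[c](subrK b); apply: exactD => //.
exact: exact_forget e1.
Qed.

End injectivity.

(** * Connecting homomorphisms and the homotopy coequaliser on cochains *)

Section lifting.
Context {RR : realType} {R : comPzRingType}.
Notation I := (@unit_itv RR).

Lemma coh_map_square n (P Q Q' S : spair) (f : spmap P Q) (g : spmap Q S)
    (f' : spmap P Q') (g' : spmap Q' S) (u : coh RR R n S) :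
  (forall x, g (f x) = g' (f' x)) ->
  coh_map f (coh_map g u) = coh_map f' (coh_map g' u).
Proof.
move=> fg; have [z ->] := clsP u; rewrite !coh_map_cls.
congr cls; apply: val_inj; rewrite /= !cpull_comp.
by apply/funext => s; congr (val z _); apply/continuousEP => x; exact: fg.
Qed.

(** Equality of classes gives the differential of the extension by zero only up to a relative
    coboundary; its primitive is absorbed into the extension, so both equations hold exactly. *)
Lemma connecting_lift n (P : spair) (y : cocycles RR R n (abs (part P)))
    (z : cocycles RR R n.+1 P) :
  connecting (cls y) = cls z ->
  exists c : cochain RR R n P,
    cpull (incl (part P)) c = val y /\ diff c = val z.
Proof.
have hc : diff (extend0 (val y)) \in @cocycle RR R n.+1 P.
  exact: connecting_cocycle.
rewrite (connecting_cls hc (extend0K _)) => /cls_eqP /= [w rw dw].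
exists (extend0 (val y) - w); rewrite !linearB /= extend0K rw dw subr0.
by rewrite opprB addrC subrK.
Qed.

Section hcoeq_cochains.
Context {X Y : topologicalType} (f g : continuousType Y X).
Notation base := (hcoeq_base RR f g).
Notation cyl := (hcoeq_cyl RR f g).

Lemma hcoeq_cyl1 : ccomp (cyl_incl Y I1) cyl = ccomp f base.
Proof. by apply/continuousEP => y; apply/hcoeq_piP; rewrite /= eqxx. Qed.

Lemma hcoeq_cyl0 : ccomp (cyl_incl Y I0) cyl = ccomp g base.
Proof.
apply/continuousEP => y; apply/hcoeq_piP; rewrite /= eqxx.
by rewrite eq_sym (negbTE I1_neq0).
Qed.

Lemma prism_cyl_exact n (c : cochain RR R n (hcoeq RR f g)) :
  exact_cochain (prism (diff (cpull cyl c)) -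
    (cpull f (cpull base c) - cpull g (cpull base c))
    : cochain RR R n (abs Y)).
Proof.
have := @prism_exact RR R n (abs Y) (cpull cyl c) (cyl_relative_abs _).
rewrite !cpull_comp hcoeq_cyl1 hcoeq_cyl0 -!cpull_comp => /exactN.
by rewrite opprB.
Qed.

(** With [z] equal to a cocycle [w] pulled back from the suspension plus [diff c], the prism of the
    first part gives [s] and that of the second gives the difference of the two pullbacks of [c],
    each modulo exact cochains. *)
Lemma hcoeq_delta_cochain n (s : cocycles RR R n (abs Y))
    (z : cocycles RR R n.+1 (abs (hcoeq RR f g))) :
  hcoeq_delta (f := f) (g := g) (cls s) (cls z) ->
  exists2 c : cochain RR R n (hcoeq RR f g),
    diff (cpull base c) = cpull base (val z) &
    exact_cochain (prism (cpull cyl (val z)) -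
      (cpull f (cpull base c) - cpull g (cpull base c)) - val s
      : cochain RR R n (abs Y)).
Proof.
move=> [v [b [b1 b0 vb]] zv].
have [w vE] := clsP v; have [y bE] := clsP b; subst v b.
move: b1 b0 vb zv; rewrite /pull !coh_map_cls.
move=> /cls_eqP /= b1 /cls_eq0 /= b0 /esym /connecting_lift[h [hy /= dh]].
move=> /cls_eqP /= [c _ dc].
have /cocycleP[rw _] := valP w.
exists c.
  (* The base is collapsed to the suspension point, where the relative cocycle [w] vanishes. *)
  rewrite diff_cpull dc linearB /= -[RHS]subr0; congr (_ - _).
  apply/funext => t; rewrite cpull_comp.
  by apply: ((relativeP _).1 rw) => x /=; exact: (hcoeq_map_pi (RR := RR) _ _ (inr _)).
(* On the cylinder the suspended part acquires the primitive [h], which restricts to [s] at the end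
   1 and to zero at the end 0, up to exact cochains. *)
have -> : cpull cyl (val z) = diff (cpull cyl c) + diff h.
  rewrite dh diff_cpull dc linearB /= cpull_comp.
  have -> : ccomp cyl (collapse f g) = cyl_collapse RR Y.
    by apply/continuousEP => -[y0 t0]; exact: (hcoeq_map_pi (RR := RR) _ _ (inl _)).
  by rewrite subrK.
have eh := @prism_exact RR R n (abs Y) h (cyl_relative_abs _).
have h1 : cpull (cyl_incl Y I1) h = cpull (end1 RR Y) (val y).
  by rewrite -hy cpull_comp; congr (cpull _ h); exact/continuousEP.
have h0 : cpull (cyl_incl Y I0) h = cpull (end0 RR Y) (val y).
  by rewrite -hy cpull_comp; congr (cpull _ h); exact/continuousEP.
have {}b1 : exact_cochain (cpull (cyl_incl Y I1) h - val s
    : cochain RR R n (abs Y)) by rewrite h1; exact: b1.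
have {}b0 : exact_cochain (cpull (cyl_incl Y I0) h
    : cochain RR R n (abs Y)) by rewrite h0; exact: b0.
have := exactD (exactB (prism_cyl_exact c) eh) (exactB b1 b0).
rewrite (linearD (@prism RR R n Y)); congr exact_cochain.
have E (p d e1 e0 q u : cochain RR R n Y) :
    p - d - (e1 - e0 - q) + (e1 - u - e0) = p + q - d - u.
  by apply/funext => t; rewrite !fctE; ring.
exact: E.
Qed.

End hcoeq_cochains.
End lifting.

(** * Scalar multiplication on the total space *)

Section bundles.
Context {RR : realType} {X : topologicalType} {r : nat} (E : vbundle RR X r).
Notation I := (@unit_itv RR).

(** Joint continuity is read off from the local trivializations; it is what makes the contraction
    onto the zero section a homotopy. *)
Lemma vscale_continuous : continuous (fun q : RR * tot E => vscale q.1 q.2).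
Proof.
move=> [c e].
have [U [h [k [oU Ue T]]]] := locally_trivial E (proj E e).
pose W := [set q : RR * tot E | U (proj E q.2)].
have cp : continuous (fun q : RR * tot E => proj E q.2).
  exact: comp_continuous (@snd_continuous _ _) (@ccont _ _ (proj E)).
have oW : open W by move/continuousP: (cp) => /(_ U oU).
have cW : {within W, continuous (fun q : RR * tot E => vscale q.1 q.2)}.
  apply: (@within_eq (RR * tot E)%type (tot E) W (fun q => k (proj E q.2) (q.1 *: h q.2))).
    move=> [d v] /= Uv; rewrite -(triv_scale T)//.
    by rewrite -{1}(proj_scale d v) (trivK T)// proj_scale.
  apply: (@within_comp (RR * tot E)%type (X * 'rV[RR]_r)%type (tot E) W _
    (fun q => (proj E q.2, q.1 *: h q.2)) (fun p => k p.1 p.2) _ _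
    (triv_inv_continuous T)) => //.
  apply: within_pair; first exact: continuous_subspaceT.
  have ch : {within W, continuous (fun q : RR * tot E => h q.2)}.
    apply: (within_comp _ _ (triv_continuous T)) => //.
    by apply: continuous_subspaceT; exact: snd_continuous.
  move/subspace_continuousP: ch => ch; apply/subspace_continuousP => q Wq.
  apply: cvgZ; last exact: ch.
  by apply: cvg_within_filter; exact: cvg_fst.
move: cW; rewrite continuous_open_subspace// => cW.
by apply: cW; rewrite inE.
Qed.

Lemma vscale1 (e : tot E) : vscale 1 e = e.
Proof.
have [U [h [k [oU Ue T]]]] := locally_trivial E (proj E e).
rewrite -[RHS](trivK T)// -[LHS](trivK T) ?proj_scale//.
by rewrite (triv_scale T)// scale1r.
Qed.

End bundles.

(** * A cocycle representing the difference of the two pullbacks *)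

Section secondary.
Context {RR : realType} {R : comPzRingType} {G : topologicalGroupType}.
Context {X : topologicalType} {n : nat} {a : gaction G X}.
Context {E : vbundle RR X n.+1} (A : equivariant a E).
Notation I := (@unit_itv RR).
Notation p2 Y := (@pr2 G Y).
Notation base := (hcoeq_base RR (act_map a) (p2 X)).
Notation cyl := (hcoeq_cyl RR (act_map A) (p2 (tot E))).

Lemma thom_class_base (o : orientation (R := R) n.+1 E)
    (o' : orientation (R := R) n.+1 (nG_family A)) u :
  induced_orientation o o' -> is_thom_class o' u ->
  is_thom_class o (coh_map (nG_base_pmap A) u).
Proof.
move=> [oE _] tu x; rewrite -oE; rewrite -tu.
exact: coh_map_square.
Qed.

Lemma prism_relative_cyl (z : cochain RR R n.+1 (tot (nG_family A))) :
  relative (z : cochain RR R n.+1 (tot_pair (nG_family A))) ->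
  relative (prism (cpull cyl z) : cochain RR R n (prod_pair (G := G) E)).
Proof.
move=> rz; apply: prism_relative.
apply/funext => s; apply: ((relativeP _).1 rz) => x.
have s0 := set_valP (s x).1; move=> /= /(@range_nG_zsec _ _ _ _ _ _ A).
exact: s0.
Qed.

Lemma pull_comp k (Y Z W : topologicalType) (f : continuousType Y Z)
    (g : continuousType Z W) (x : coh RR R k (abs W)) :
  pull f (pull g x) = pull (ccomp f g) x.
Proof.
have [z ->] := clsP x; rewrite /pull !coh_map_cls; congr cls.
by apply: val_inj; exact: cpull_comp.
Qed.

(** Scaling by t in the unit interval joins the inclusion of the nonzero vectors, at t = 1, to the
    projection followed by the zero section, at t = 0. *)
Lemma pull_zsec_p0 (x : coh RR R n (abs (G * tot E)%type)) :
  pull (id_p0 (G := G) (E := E)) (pull (id_map (G := G) (zsec E)) x) =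
  pull (id_map (G := G) (incl (nonzero E))) x.
Proof.
have cH : continuous (fun q : (G * tot0 E) * I =>
    (q.1.1, vscale (set_val q.2) (set_val q.1.2)) : G * tot E).
  apply: pair_continuous.
    exact: comp_continuous (@fst_continuous _ _) (@fst_continuous _ _).
  apply: (@comp_continuous _ _ _
    (fun q : (G * tot0 E) * I => (set_val q.2, set_val q.1.2) : RR * tot E)
    _ _ (@vscale_continuous RR X n.+1 E)).
  apply: pair_continuous.
    exact: comp_continuous (@snd_continuous _ _) (@set_val_continuous _ _).
  apply: (@comp_continuous _ _ _ (fun q : (G * tot0 E) * I => q.1)
    (fun p : G * tot0 E => set_val p.2) (@fst_continuous _ _)).
  exact: comp_continuous (@snd_continuous _ _) (@set_val_continuous _ _).
have := homotopic_pull (mkcts cH) x.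
have -> : ccomp (cyl_incl _ I1) (mkcts cH) = id_map (G := G) (incl (nonzero E)).
  by apply/continuousEP => q; congr pair; exact: vscale1.
move=> ->; rewrite pull_comp; congr (pull _ x).
apply/continuousEP => -[g e]; congr pair.
by rewrite -[LHS]/(zsec E (proj E (set_val e))) zsecE.
Qed.

(** The restriction of [d] to the nonzero vectors loses its prism term, since [z] is relative. Hence
    its pullback along the zero section solves the equation defining [dPhi], and injectivity
    identifies it with the chosen solution. *)
Lemma secondary_class_cochain (alpha : cocycles RR R n (abs (tot0 E)))
    (z : cocycles RR R n.+1 (tot_pair (nG_family A)))
    (h : cochain RR R n (tot E)) :
  cpull (incl (nonzero E)) h = val alpha ->
  diff h = cpull (nG_base_pmap A) (val z) ->
  let d := cpull (act_map A) h - cpull (p2 (tot E)) h - prism (cpull cyl (val z)) in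
  exists hd : diff d = 0,
    dPhi A (cls alpha) =
    pull (id_map (G := G) (zsec E)) (cls (mk_cocycle (cocycle_abs hd))).
Proof.
move=> ha dh d; have /cocycleP[rz dz] := valP z.
have hd : diff d = 0.
  have := prism_diff (cpull cyl (val z)).
  rewrite diff_cpull dz !linear0 add0r !cpull_comp hcoeq_cyl1 hcoeq_cyl0.
  rewrite /d !linearB /= => ->.
  by rewrite !diff_cpull dh !cpull_comp subrr.
exists hd; set D := pull _ _.
have DE : pull (id_p0 (G := G) (E := E)) D =
    pull (act_map (tact0 A)) (cls alpha) - pull (p2 (tot0 E)) (cls alpha).
  rewrite /D pull_zsec_p0 /pull !coh_map_cls.
  apply: (@addIr _ (cls (cocycle_map
    (abs_map (P := abs (tot0 E)) (p2 (tot0 E))) alpha))).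
  rewrite subrK -clsD; congr cls; apply: val_inj.
  rewrite /= /d !linearB /= -ha !cpull_comp.
  have -> : cpull (id_map (G := G) (incl (nonzero E)))
      (prism (cpull cyl (sval z))) = 0.
    apply/funext => s; apply: ((relativeP (P := prod_pair (G := G) E) _).1
      (prism_relative_cyl rz)) => x.
    exact: set_valP (s x).2.
  have -> : ccomp (id_map (G := G) (incl (nonzero E))) (act_map A) =
      ccomp (act_map (tact0 A)) (incl (nonzero E)) by exact/continuousEP.
  have -> : ccomp (id_map (G := G) (incl (nonzero E))) (p2 (tot E)) =
      ccomp (p2 (tot0 E)) (incl (nonzero E)) by exact/continuousEP.
  by rewrite subr0 subrK.
apply/eqP; rewrite -subr_eq0; apply/eqP.
apply: (@pull_id_p0_inj _ _ _ _ _ E).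
rewrite /pull linearB; apply/eqP; rewrite subr_eq0; apply/eqP.
rewrite [RHS]DE /dPhi; set S := [set _ | _].
(* A solution exists, so [xget] returns one and not its default 0. *)
have SD : exists d', S d' by exists D.
exact: (xgetPex 0 SD).
Qed.

End secondary.

(** * Comparison of the secondary classes modulo the indeterminacy *)

Theorem proposition1p1p33 (RR : realType) (R : comPzRingType)
    (G : topologicalGroupType) (X : topologicalType) (n : nat)
    (a : gaction G X) (E : vbundle RR X n.+1) (A : equivariant a E)
    (o : orientation (R := R) n.+1 E) :
  path_connected RR X ->
  preserves_orientation A o ->
  is_euler_class o 0 ->
  forall (aE : coh RR R n (abs (tot0 E)))
      (se : coh RR R n (abs (G * X)%type)),
    is_secondary_thom_class o aE ->
    is_secondary_equivariant_euler_class A o se ->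
    indeterminacy a (dPhi A aE - - se).
Proof.
move=> _ _ _ aE se taE [e nse [o' oo' [u tu eE]]]; subst e.
have [alpha aEE] := clsP aE; have [s seE] := clsP se; have [z uE] := clsP u.
subst aE se u.
(* Both sides are Thom classes of [E]; their equality yields an extension [h] of [alpha] whose
   differential is exactly the restriction of [z]. *)
have /connecting_lift[h [ha dh]] : connecting (P := tot_pair E) (cls alpha) =
    cls (cocycle_map (nG_base_pmap A) z).
  rewrite -coh_map_cls; apply: thom_class_unique taE _.
  exact: thom_class_base oo' tu.
have [hd ->] := secondary_class_cochain ha dh.
move: nse; rewrite coh_map_cls => /hcoeq_delta_cochain[c dc ec].
(* Neither term is closed, but both have as differential the restriction to [X] of the cocycle
   representing the Euler class. *)
pose m := cpull (zsec E) h - cpull (hcoeq_base RR (act_map a) (@pr2 G X)) c.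
have dm : diff m = 0.
  rewrite /m linearB /= dc diff_cpull dh /= !cpull_comp.
  apply/eqP; rewrite subr_eq0; apply/eqP; congr (cpull _ (val z)).
  by apply/continuousEP => x; rewrite /= nG_zsec_pi.
exists (cls (mk_cocycle (cocycle_abs dm))) => //.
rewrite opprK /pull !coh_map_cls; apply/eqP; rewrite subr_eq; apply/eqP.
rewrite -!clsD; apply/cls_eqP => /=; rewrite /m !linearB /=.
pose zG := id_map (G := G) (zsec E).
have E1 : cpull zG (cpull (act_map A) h) = cpull (act_map a) (cpull (zsec E) h).
  rewrite !cpull_comp; congr (cpull _ h); apply/continuousEP => q.
  by rewrite -[RHS]/(zsec E (act_map a q)) (nG_zsec_act A).
have E2 : cpull zG (cpull (@pr2 G (tot E)) h) =
    cpull (@pr2 G X) (cpull (zsec E) h).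
  by rewrite !cpull_comp; congr (cpull _ h); exact/continuousEP.
have E3 : cpull zG (prism (cpull (hcoeq_cyl RR (act_map A) (@pr2 G (tot E)))
      (val z))) =
    prism (cpull (hcoeq_cyl RR (act_map a) (@pr2 G X))
      (cpull (zsec (nG_family A)) (val z))).
  rewrite -prism_cpull !cpull_comp; congr (prism (cpull _ (val z))).
  by apply/continuousEP => q; apply/esym/(nG_zsec_pi A (inl q)).
(* The two pullbacks of [h] cancel, and what is left is the cochain shown exact by [ec]. *)
have EE (u v p b1 b2 t : cochain RR R n (G * X)%type) :
    p - (b1 - b2) - t = u - b1 - (u - v - p + t + (v - b2)).
  by apply/funext => y; rewrite !fctE; ring.
by rewrite -[cpull zG _]/(cpull zG _) E1 E2 E3 -EE.
Qed.
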